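(* Let $K\in\mathcal{K}^2$. Then $$\frac{\mathrm{A}(K)}{\mathrm{w}_B(K)^2}\geq \frac{4}{\sqrt{3}},$$ with equality if and only if $K$ is an equilateral triangle.
   Context: $\mathcal{K}^2$ is the family of planar convex bodies (compact convex subsets of $\mathbb{R}^2$) with non-empty interior. For a compact set $S\subset\mathbb{R}^2$, $\mathrm{A}(S)$ is its area (2-dimensional Lebesgue measure) and $\mathrm{w}(S)$ its (minimum) width, i.e. the shortest distance between two parallel lines containing $S$ between them. A bisection of $K\in\mathcal{K}^2$ is a pair of closed sets $(K_1,K_2)$ such that (i) $K=K_1\cup K_2$, and (ii) $K_1\cap K_2=l([-1,1])$, where $l:[-1,1]\to K$ is an injective continuous curve whose endpoints $l(-1),l(1)$ are the only points of the curve lying in the boundary of $K$. $\mathcal{B}(K)$ is the set of all bisections of $K$, and $\mathrm{w}_B(K)=\inf_{(K_1,K_2)\in\mathcal{B}(K)}\max\{\mathrm{w}(K_1),\mathrm{w}(K_2)\}$. *)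

(* Defs.v *)
From HB Require Import structures.
From mathcomp Require Import all_boot all_order all_algebra.
From mathcomp Require Import all_classical all_reals all_analysis.

Set Implicit Arguments.
Unset Strict Implicit.
Unset Printing Implicit Defensive.
Import Order.TTheory GRing.Theory Num.Theory.
Import numFieldNormedType.Exports.
Local Open Scope classical_set_scope.
Local Open Scope ring_scope.

(* The plane is R * R: its product topology is the Euclidean one, but the norm
   `|x| inherited from the library is the sup norm, hence dotp and dist below. *)
Definition dotp (R : realType) (x y : R * R) : R := x.1 * y.1 + x.2 * y.2.

Definition dist (R : realType) (x y : R * R) : R :=
  Num.sqrt (dotp (x - y) (x - y)).

Definition frontier (T : topologicalType) (A : set T) : set T :=
  closure A `\` A°.

Definition convex_body (R : realType) (K : set (R * R)) : Prop :=
  [/\ compact K, convex_set K & K° !=set0].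

(* fine maps +oo to 0; the area of a compact set is finite. *)
Definition area (R : realType) (S : set (R * R)) : R :=
  fine ((lebesgue_measure \x lebesgue_measure)%E S).

(* The lines <u, x> = a and <u, x> = b with unit normal u are parallel, at
   distance b - a; S lies between them. *)
Definition between_lines (R : realType) (S : set (R * R)) (u : R * R)
    (a b : R) : Prop :=
  [/\ dotp u u = 1, a <= b & forall x, S x -> a <= dotp u x <= b].

Definition width (R : realType) (S : set (R * R)) : R :=
  inf [set d : R | exists u a b, between_lines S u a b /\ d = b - a].

Definition bisecting_curve (R : realType) (K : set (R * R)) (l : R -> R * R) : Prop :=
  [/\ {within `[-1, 1], continuous l},
      {in `[-1, 1] &, injective l},
      l @` `[-1, 1] `<=` K
    & forall t : R, t \in `[-1, 1] -> frontier K (l t) <-> t = -1 \/ t = 1].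

Definition bisection (R : realType) (K K1 K2 : set (R * R)) : Prop :=
  [/\ closed K1, closed K2, K = K1 `|` K2
    & exists2 l : R -> R * R, bisecting_curve K l & K1 `&` K2 = l @` `[-1, 1]].

Definition bisecting_width (R : realType) (K : set (R * R)) : R :=
  inf [set m : R | exists K1 K2,
    bisection K K1 K2 /\ m = Num.max (width K1) (width K2)].

Definition triangle (R : realType) (a b c : R * R) : set (R * R) :=
  [set x | exists r s t : R, [/\ 0 <= r, 0 <= s, 0 <= t, r + s + t = 1
    & x = r *: a + s *: b + t *: c]].

Definition equilateral_triangle (R : realType) (K : set (R * R)) : Prop :=
  exists a b c : R * R, [/\ 0 < dist a b, dist a b = dist b c,
    dist b c = dist c a & K = triangle a b c].

(* Main.v *)
(* w_B(K) = w(K)/2 for the equilateral triangle and w_B(K) <= w(K)/2 in general: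
   a chord halving a strip bisects K, and two planks covering an equilateral
   triangle of height h have total width at least h. So the theorem reduces to
   Pal's inequality A(K) >= w(K)^2 / sqrt 3 with its equality case.

   For Pal's inequality take a triangle abc of maximal area D/2 inscribed in K,
   and let b1, b2, b3 in [0,1] be such that K extends beyond the side of length
   l_i by b_i times the corresponding altitude. The four triangles abc and the
   three erected on its sides towards the extreme points of K do not overlap,
   hence A(K) >= (D/2)(1 + b1 + b2 + b3). The width of K across the i-th side
   gives w l_i <= D (1 + b_i), and l1^2 + l2^2 + l3^2 >= 2 sqrt 3 D (Weitzenbock),
   so 2 sqrt 3 w^2 <= D sum (1 + b_i)^2 <= 3 D (1 + b1 + b2 + b3).
   Equality forces abc equilateral and all b_i equal to 0 (then K = abc) or all
   equal to 1 (then the extreme points span a triangle of area 2D). *)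
Require Import Defs.
From mathcomp Require Import all_boot all_order all_algebra.
From mathcomp Require Import all_classical all_reals all_analysis.
From mathcomp Require Import measurable_realfun.
From mathcomp Require Import ring lra.
Import Order.TTheory GRing.Theory Num.Theory.
Import numFieldNormedType.Exports.
Local Open Scope classical_set_scope.
Local Open Scope ring_scope.

(** * Triangles and barycentric coordinates *)

(** Twice the signed area of the triangle [a b c], positive for counterclockwise vertices. As a
    function of one vertex it is the signed distance to the line through the other two, times their
    distance. *)
Definition cross {R : realType} (a b c : R * R) : R :=
  (b.1 - a.1) * (c.2 - a.2) - (b.2 - a.2) * (c.1 - a.1).

Lemma pairE {R : realType} :
  ((forall a b : R * R, ((a + b).1 = a.1 + b.1)%R) *
   (forall a b : R * R, ((a + b).2 = a.2 + b.2)%R) *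
   (forall a : R * R, ((- a).1 = - a.1)%R) *
   (forall a : R * R, ((- a).2 = - a.2)%R) *
   (forall r (a : R * R), ((r *: a).1 = r * a.1)%R) *
   (forall r (a : R * R), ((r *: a).2 = r * a.2)%R))%type.
Proof. by []. Qed.

Lemma pair_ext {R : realType} (a b : R * R) : a.1 = b.1 -> a.2 = b.2 -> a = b.
Proof. by case: a b => [? ?] [? ?] /= -> ->. Qed.

Lemma cross_rot {R : realType} (a b c : R * R) : cross a b c = cross b c a.
Proof. by rewrite /cross; ring. Qed.

Lemma cross_swap {R : realType} (a b c : R * R) : cross a c b = - cross a b c.
Proof. by rewrite /cross; ring. Qed.

Lemma cross_split {R : realType} (a b c x : R * R) :
  cross x b c + cross a x c + cross a b x = cross a b c.
Proof. by rewrite /cross; ring. Qed.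

Lemma dist_sqr {R : realType} (a b : R * R) :
  dist a b ^+ 2 = (a.1 - b.1) ^+ 2 + (a.2 - b.2) ^+ 2.
Proof. by rewrite /dist sqr_sqrtr /dotp /= -!expr2 // addr_ge0 // sqr_ge0. Qed.

Lemma dist_ge0 {R : realType} (a b : R * R) : 0 <= dist a b.
Proof. exact: sqrtr_ge0. Qed.

(** Cramer's rule: the barycentric coordinates of [x] are ratios of signed areas, and by
    [cross_split] they sum to 1. *)
Lemma cross_barycenter {R : realType} (a b c x : R * R) : cross a b c != 0 ->
  x = (cross x b c / cross a b c) *: a + (cross a x c / cross a b c) *: b
      + (cross a b x / cross a b c) *: c.
Proof.
by move=> h; apply: pair_ext; rewrite !pairE; move: h; rewrite /cross => h; field.
Qed.

Lemma triangle_cross {R : realType} (a b c x : R * R) : 0 < cross a b c ->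
  triangle a b c x <->
  [/\ 0 <= cross x b c, 0 <= cross a x c & 0 <= cross a b x].
Proof.
move=> D0; split=> [[r [s [t [r0 s0 t0 rst ->]]]]|[x0 y0 z0]].
  have {}rst : r = 1 - s - t by lra.
  subst r.
  have [-> -> ->] : [/\ cross ((1 - s - t) *: a + s *: b + t *: c) b c
                        = (1 - s - t) * cross a b c,
    cross a ((1 - s - t) *: a + s *: b + t *: c) c = s * cross a b c &
    cross a b ((1 - s - t) *: a + s *: b + t *: c) = t * cross a b c].
    by rewrite /cross !pairE; split; ring.
  by split; apply: mulr_ge0 => //; apply: ltW.
exists (cross x b c / cross a b c), (cross a x c / cross a b c),
  (cross a b x / cross a b c); split; try by rewrite divr_ge0 // ltW.
  by rewrite -!mulrDl cross_split divff // gt_eqF.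
by apply: cross_barycenter; rewrite gt_eqF.
Qed.

Lemma triangle_swap {R : realType} (a b c : R * R) :
  triangle a c b = triangle a b c.
Proof.
apply/seteqP; split=> x [r [s [t [r0 s0 t0 e ->]]]]; exists r, t, s;
  by split=> //; [rewrite -e addrAC | rewrite addrAC].
Qed.

Lemma convex_comb {R : realType} {K : set (R * R)} (x y : R * R) (t : R) :
  convex_set K -> K x -> K y -> 0 <= t -> t <= 1 ->
  K (t *: x + (1 - t) *: y).
Proof.
move=> cK Kx Ky t0 t1.
by have := cK x y (Itv01 t0 t1); rewrite !inE; apply.
Qed.

(** * Widths *)

Lemma width_lbound {R : realType} (S : set (R * R)) :
  lbound [set d : R | exists u a b, between_lines S u a b /\ d = b - a] 0.
Proof. by move=> _ [u [a [b [[_ ab _] ->]]]]; rewrite subr_ge0. Qed.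

Lemma width_ge0 {R : realType} (S : set (R * R)) : 0 <= width S.
Proof.
rewrite /width; set E := [set d : R | _].
have [->|/set0P E0] := eqVneq E set0; first by rewrite inf0.
exact/lb_le_inf/width_lbound.
Qed.

Lemma width_le {R : realType} (S : set (R * R)) (u : R * R) (a b : R) :
  between_lines S u a b -> width S <= b - a.
Proof.
move=> h; apply: ge_inf; last by exists u, a, b.
by exists 0; exact: width_lbound.
Qed.

(** Bounds on [cross x p q] confine [S] to a strip parallel to the line [p q], of width
    [(M - m) / dist p q]. The product form also covers [p = q]. *)
Lemma width_dist_le {R : realType} (S : set (R * R)) (p q : R * R) (m M : R) :
  S !=set0 -> (forall x, S x -> m <= cross x p q <= M) ->
  width S * dist p q <= M - m.
Proof.
move=> [x0 Sx0] h.
have mM : m <= M by have /andP[] := h _ Sx0; exact: le_trans.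
have [->|d0] := eqVneq (dist p q) 0; first by rewrite mulr0 subr_ge0.
have {}d0 : 0 < dist p q by rewrite lt_neqAle eq_sym d0 dist_ge0.
rewrite -ler_pdivlMr //.
(* The value at the origin, subtracted to turn the affine [cross x p q] into the linear form
   [dotp u x]. *)
pose k := cross 0 p q.
pose u := ((p.2 - q.2) / dist p q, (q.1 - p.1) / dist p q).
have -> : (M - m) / dist p q = (M - k) / dist p q - (m - k) / dist p q.
  by rewrite -mulrBl; congr (_ * _); ring.
have du x : dotp u x = (cross x p q - k) / dist p q.
  by rewrite /dotp /u /k /cross /=; ring.
apply: (@width_le _ _ u); split.
- have h2 := dist_sqr p q.
  rewrite /dotp /u /=.
  have -> : 1 = dist p q ^+ 2 / dist p q ^+ 2 by rewrite divff ?sqrf_eq0 ?gt_eqF.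
  by rewrite {1}h2; field; rewrite gt_eqF.
- by rewrite ler_pM2r ?invr_gt0 // lerD2r.
- by move=> x /h /andP[h1 h2]; rewrite du !ler_pM2r ?invr_gt0 // !lerD2r h1.
Qed.

(* Rotating [b] around [a] by a sixth of a turn gives the apex of an
   equilateral triangle on [a b]; the last summand is the squared distance from
   [c] to that apex, so the identity is Weitzenbock's inequality with its
   equality case. *)
Lemma weitzenbock {R : realType} (a b c : R * R) :
  dist a b ^+ 2 + dist b c ^+ 2 + dist c a ^+ 2 =
  2 * Num.sqrt 3 * cross a b c +
  2 * ((c.1 - a.1 - ((b.1 - a.1) / 2 - Num.sqrt 3 / 2 * (b.2 - a.2))) ^+ 2 +
       (c.2 - a.2 - ((b.2 - a.2) / 2 + Num.sqrt 3 / 2 * (b.1 - a.1))) ^+ 2).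
Proof.
have s3 : Num.sqrt 3 ^+ 2 = 3 :> R by rewrite sqr_sqrtr.
rewrite !dist_sqr /cross.
set s := Num.sqrt 3 in s3 *.
have -> : forall A B C X : R, (C - (A / 2 - s / 2 * B)) ^+ 2 +
  (X - (B / 2 + s / 2 * A)) ^+ 2 = C ^+ 2 + X ^+ 2 - C * A - X * B
   + s * (C * B - X * A) + (A ^+ 2 + B ^+ 2) / 4 + s ^+ 2 * (A ^+ 2 + B ^+ 2) / 4.
  by move=> A B C X; field.
by rewrite s3; field.
Qed.

(** Both squares of the remainder vanish, so [c] is the apex of the equilateral triangle on
    [a b]. *)
Lemma weitzenbock_eq {R : realType} (a b c : R * R) :
  dist a b ^+ 2 + dist b c ^+ 2 + dist c a ^+ 2 = 2 * Num.sqrt 3 * cross a b c ->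
  dist a b = dist b c /\ dist b c = dist c a.
Proof.
rewrite weitzenbock.
set X := _ - _ - (_ - _); set Y := _ - _ - (_ + _) => /eqP.
rewrite addrC -subr_eq0 addrK mulf_eq0 pnatr_eq0 /= paddr_eq0 ?sqr_ge0 //.
rewrite !sqrf_eq0 /X /Y !subr_eq0 => /andP[/eqP h1 /eqP h2].
have s3 : Num.sqrt 3 ^+ 2 = 3 :> R by rewrite sqr_sqrtr.
have e1 : dist a b ^+ 2 = dist c a ^+ 2.
  rewrite !dist_sqr h1 h2.
  have -> : forall A B s : R, (A / 2 - s / 2 * B) ^+ 2 + (B / 2 + s / 2 * A) ^+ 2
     = (1 + s ^+ 2) / 4 * (A ^+ 2 + B ^+ 2) by move=> A B s; field.
  by rewrite s3; field.
have e2 : dist b c ^+ 2 = dist c a ^+ 2.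
  rewrite -e1 !dist_sqr.
  have -> : b.1 - c.1 = (b.1 - a.1) / 2 + Num.sqrt 3 / 2 * (b.2 - a.2).
    have -> : b.1 - c.1 = (b.1 - a.1) - (c.1 - a.1) by ring.
    by rewrite h1; field.
  have -> : b.2 - c.2 = (b.2 - a.2) / 2 - Num.sqrt 3 / 2 * (b.1 - a.1).
    have -> : b.2 - c.2 = (b.2 - a.2) - (c.2 - a.2) by ring.
    by rewrite h2; field.
  have -> : forall A B s : R, (A / 2 + s / 2 * B) ^+ 2 + (B / 2 - s / 2 * A) ^+ 2
     = (1 + s ^+ 2) / 4 * (A ^+ 2 + B ^+ 2) by move=> A B s; field.
  by rewrite s3; field.
by split; apply/eqP; rewrite -(@eqrXn2 _ 2) ?dist_ge0 // ?e1 ?e2.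
Qed.

(** Here [D] is twice the area of the inscribed triangle, the [L] are its squared sides and [E] is
    the remainder in Weitzenbock's inequality. On [[0, 1]] one has [(1 + b)^2 = 1 + 3 b - (b - b^2)]
    with [b - b^2 >= 0]. Summing the three hypotheses leaves [W * E] and the three gaps as
    nonnegative slack, all of which vanish under equality. *)
Lemma pal_arith {R : realType} (w D E L1 L2 L3 b1 b2 b3 : R) :
  0 <= w -> 0 < D -> 0 <= E ->
  0 <= b1 <= 1 -> 0 <= b2 <= 1 -> 0 <= b3 <= 1 ->
  w ^+ 2 * L1 <= (D * (1 + b1)) ^+ 2 -> w ^+ 2 * L2 <= (D * (1 + b2)) ^+ 2 ->
  w ^+ 2 * L3 <= (D * (1 + b3)) ^+ 2 ->
  L1 + L2 + L3 = 2 * Num.sqrt 3 * D + E ->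
  w ^+ 2 / Num.sqrt 3 <= D / 2 * (1 + b1 + b2 + b3) /\
  (w ^+ 2 / Num.sqrt 3 = D / 2 * (1 + b1 + b2 + b3) -> 0 < w ->
   [/\ E = 0, [/\ b1 ^+ 2 = b1, b2 ^+ 2 = b2 & b3 ^+ 2 = b3] &
    [/\ w ^+ 2 * L1 = (D * (1 + b1)) ^+ 2, w ^+ 2 * L2 = (D * (1 + b2)) ^+ 2 &
    w ^+ 2 * L3 = (D * (1 + b3)) ^+ 2]]).
Proof.
move=> w0 D0 E0 hb1 hb2 hb3 h1 h2 h3 hL.
have s0 : 0 < Num.sqrt 3 :> R by rewrite sqrtr_gt0.
have s3 : Num.sqrt 3 ^+ 2 = 3 :> R by rewrite sqr_sqrtr.
have -> : w ^+ 2 / Num.sqrt 3 = w ^+ 2 * Num.sqrt 3 / 3.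
  by rewrite -{3}s3; field; rewrite gt_eqF.
set s := Num.sqrt 3 in s0 s3 hL *; set W := w ^+ 2 in h1 h2 h3 *.
have W0 : 0 <= W by rewrite sqr_ge0.
have WE : 0 <= W * E by rewrite mulr_ge0.
have c (b : R) : 0 <= b <= 1 -> 0 <= D ^+ 2 * (b - b ^+ 2).
  by move=> hb; rewrite mulr_ge0 ?sqr_ge0 //; nra.
have {}hb1 := c _ hb1; have {}hb2 := c _ hb2; have {}hb3 := c _ hb3.
have key : 2 * s * D * W + W * E = W * L1 + W * L2 + W * L3.
  by rewrite -!mulrDr hL; ring.
split.
  rewrite -(ler_pM2r D0) -(ler_pM2r (_ : 0 < 6)) //.
  set t := (X in X <= _); have -> : t = 2 * s * D * W by rewrite /t; field.
  by lra.
move=> e wpos.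
have Wp : 0 < W by rewrite exprn_gt0.
have D2 : 0 < D ^+ 2 by rewrite exprn_gt0.
have e' : 2 * s * D * W = 3 * D ^+ 2 * (1 + b1 + b2 + b3).
  have -> : 2 * s * D * W = 6 * D * (W * s / 3) by field.
  by rewrite e; field.
have cz (b : R) : D ^+ 2 * (b - b ^+ 2) = 0 -> b ^+ 2 = b.
  by move=> /eqP; rewrite mulf_eq0 gt_eqF //= subr_eq0 => /eqP.
have WE0 : W * E = 0 by lra.
split.
- by apply/eqP; move/eqP: WE0; rewrite mulf_eq0 gt_eqF.
- by split; apply: cz; lra.
- by split; lra.
Qed.

(** * Two planks covering an equilateral triangle *)

Lemma dotpDr {R : realType} (u x y : R * R) : dotp u (x + y) = dotp u x + dotp u y.
Proof. by rewrite /dotp !pairE; ring. Qed.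

Lemma dotpZr {R : realType} (u x : R * R) (r : R) : dotp u (r *: x) = r * dotp u x.
Proof. by rewrite /dotp !pairE; ring. Qed.

Lemma dotpC {R : realType} (u v : R * R) : dotp u v = dotp v u.
Proof. by rewrite /dotp; ring. Qed.

Lemma equilateral_dotp {R : realType} (a b c : R * R) :
  dist a b = dist b c -> dist b c = dist c a ->
  dotp (b - a) (b - a) = dist a b ^+ 2 /\ dotp (c - a) (c - a) = dist a b ^+ 2 /\
  2 * dotp (b - a) (c - a) = dist a b ^+ 2.
Proof.
move=> e1 e2.
have h1 := dist_sqr a b; have h2 := dist_sqr b c; have h3 := dist_sqr c a.
move: h1 h2 h3; rewrite -e2 -e1 /dotp !pairE => h1 h2 h3.
by split; [|split]; rewrite ?h1; lra.
Qed.

(** Lagrange's identity expresses the squared area by the inner products of two sides. *)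
Lemma equilateral_cross {R : realType} (a b c : R * R) :
  dist a b = dist b c -> dist b c = dist c a ->
  cross a b c ^+ 2 = 3 / 4 * (dist a b ^+ 2) ^+ 2.
Proof.
move=> e1 e2; have [h1 [h2 h3]] := equilateral_dotp _ _ _ e1 e2.
have -> : cross a b c ^+ 2 = dotp (b - a) (b - a) * dotp (c - a) (c - a)
  - (2 * dotp (b - a) (c - a)) ^+ 2 / 4.
  by rewrite /dotp /cross !pairE; field.
by rewrite h1 h2 h3; field.
Qed.

Lemma equilateral_cross_neq0 {R : realType} (a b c : R * R) :
  0 < dist a b -> dist a b = dist b c -> dist b c = dist c a -> cross a b c != 0.
Proof.
move=> d0 e1 e2; rewrite -sqrf_eq0 equilateral_cross // mulf_neq0 //.
by rewrite !expf_neq0 // gt_eqF.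
Qed.

(* In barycentric coordinates a vector of length the height has coordinates at
   most 1 in absolute value, hence fits inside the triangle. *)
Lemma equilateral_chord {R : realType} (a b c u : R * R) (h : R) :
  0 < dist a b -> dist a b = dist b c -> dist b c = dist c a ->
  h ^+ 2 = 3 / 4 * dist a b ^+ 2 -> dotp u u = 1 ->
  exists y, triangle a b c y /\ triangle a b c (y + h *: u).
Proof.
move=> d0 e1 e2 eh u1.
have D0 := equilateral_cross_neq0 _ _ _ d0 e1 e2.
have [h1 [h2 h3]] := equilateral_dotp _ _ _ e1 e2.
set L := dist a b ^+ 2 in h1 h2 h3 eh.
have L0 : 0 < L by rewrite exprn_gt0.
(* [B] and [C] are the coordinates of the vector [h *: u] along [b] and [c]; the one along [a] is
   [- B - C]. *)
pose B := cross a (a + h *: u) c / cross a b c.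
pose C := cross a b (a + h *: u) / cross a b c.
have hu : h *: u = B *: (b - a) + C *: (c - a).
  have := cross_barycenter _ _ _ (a + h *: u) D0.
  rewrite -/B -/C; set A := _ / cross a b c.
  have : A + B + C = 1 by rewrite /A -!mulrDl cross_split divff.
  move=> eA; have -> : A = 1 - B - C by lra.
  move=> e; have := congr1 fst e; have := congr1 snd e; rewrite !pairE => e2' e1'.
  by apply: pair_ext; rewrite !pairE; lra.
have eBC : B ^+ 2 + C ^+ 2 + B * C = 3 / 4.
  have : dotp (h *: u) (h *: u) = 3 / 4 * L.
    by rewrite dotpZr dotpC dotpZr u1 -eh; ring.
  have -> : dotp (h *: u) (h *: u) = L * (B ^+ 2 + C ^+ 2 + B * C).
    rewrite hu !dotpDr dotpC dotpDr [dotp (_ + _) (C *: _)]dotpC dotpDr.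
    rewrite !dotpZr !(dotpC (_ *: _)) !dotpZr h1 h2 (dotpC (c - a)).
    by rewrite -[in RHS]h3; rewrite -[in LHS]h3; field.
  by rewrite mulrC => /mulIf; apply; rewrite gt_eqF.
(* Completing the square, the form is [(Y + X / 2)^2 + 3/4 X^2]. It is invariant under swapping [B]
   and [C] and under [(B, C) -> (B + C, - C)], which bounds all three coordinates. *)
have bound (X Y : R) : X ^+ 2 + Y ^+ 2 + X * Y = 3 / 4 -> -1 <= X <= 1.
  move=> e; have s0 := sqr_ge0 (Y + X / 2).
  have s1 : X ^+ 2 <= 1 by move: s0 e; rewrite sqrrD; lra.
  by rewrite -ler_norml -(@expr_le1 _ 2) // real_normK ?num_real.
have hB := bound _ _ eBC.
have hC : -1 <= C <= 1 by apply: (bound _ B); rewrite -eBC; ring.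
have hBC : -1 <= B + C <= 1 by apply: (bound _ (- C)); rewrite -eBC; ring.
suff [s [t [s0 t0 r0 [sB tC rA]]]] : exists s t, [/\ 0 <= s, 0 <= t,
    0 <= 1 - s - t & [/\ 0 <= s + B, 0 <= t + C & 0 <= 1 - s - t - B - C]].
  exists ((1 - s - t) *: a + s *: b + t *: c); split.
    by exists (1 - s - t), s, t; split=> //; ring.
  exists (1 - s - t - B - C), (s + B), (t + C); split=> //; first by ring.
  by rewrite hu; apply: pair_ext; rewrite !pairE; ring.
(* The chord starts at [s = max 0 (- B)], [t = max 0 (- C)], the least values for which both ends
   have nonnegative coordinates along [b] and [c]. *)
have [B0|B0] := leP 0 B; have [C0|C0] := leP 0 C.
- by exists 0, 0; do !split; lra.
- by exists 0, (- C); do !split; lra.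
- by exists (- B), 0; do !split; lra.
- by exists (- B), (- C); do !split; lra.
Qed.

(* Chords [y, y + H u1] and [z, z + H u2] produce, by convexity, a parallelogram
   with sides [H/2 u1], [H/2 u2] in the triangle; two narrower planks cannot
   cover its four vertices. *)
Lemma equilateral_planks {R : realType} (a b c u1 u2 : R * R)
    (K1 K2 : set (R * R)) (a1 b1 a2 b2 H : R) :
  0 < dist a b -> dist a b = dist b c -> dist b c = dist c a ->
  H ^+ 2 = 3 / 4 * dist a b ^+ 2 ->
  triangle a b c `<=` K1 `|` K2 ->
  between_lines K1 u1 a1 b1 -> between_lines K2 u2 a2 b2 ->
  H / 2 <= Num.max (b1 - a1) (b2 - a2).
Proof.
move=> d0 e1 e2 eH TK [u11 _ s1] [u22 _ s2].
have [y [Ty Ty']] := equilateral_chord _ _ _ _ _ d0 e1 e2 eH u11.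
have [z [Tz Tz']] := equilateral_chord _ _ _ _ _ d0 e1 e2 eH u22.
have mid p q : triangle a b c p -> triangle a b c q ->
    triangle a b c (2^-1 *: p + 2^-1 *: q).
  move=> [r [s [t [r0 s0 t0 e ->]]]] [r' [s' [t' [r0' s0' t0' e' ->]]]].
  exists ((r + r') / 2), ((s + s') / 2), ((t + t') / 2).
  split; [lra|lra|lra|lra|].
  by apply: pair_ext; rewrite !pairE; field.
rewrite leNgt; apply/negP; rewrite gt_max => /andP[w1 w2].
have P p q : triangle a b c p -> triangle a b c q ->
    (a1 <= (dotp u1 p + dotp u1 q) / 2 <= b1) \/
    (a2 <= (dotp u2 p + dotp u2 q) / 2 <= b2).
  move=> Tp Tq; have [/s1|/s2] := TK _ (mid _ _ Tp Tq);
    rewrite dotpDr !dotpZr -mulrDr mulrC; [by left|by right].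
(* These are the four vertices of the parallelogram. No side along [u1] has both ends in the first
   plank and no side along [u2] both in the second, so each plank holds a pair of opposite vertices.
   With [e = H * dotp u1 u2], the diagonals then project to lengths [(H + e) / 2] and [(H - e) / 2],
   which cannot both be below [H / 2]. *)
have := P _ _ Ty Tz; have := P _ _ Ty' Tz.
have := P _ _ Ty Tz'; have := P _ _ Ty' Tz'.
rewrite !dotpDr !dotpZr u11 u22 (dotpC u2 u1).
move: (dotp u1 y) (dotp u1 z) (dotp u2 y) (dotp u2 z) => t t' v v'.
have -> : H * dotp u1 u2 = dotp u1 u2 * H by rewrite mulrC.
move: (dotp u1 u2 * H) => e.
by move=> [/andP[]??|/andP[]??] [/andP[]??|/andP[]??] [/andP[]??|/andP[]??]
  [/andP[]??|/andP[]??]; lra.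
Qed.

(** * The area of a triangle *)

Local Notation mu2 := (lebesgue_measure \x lebesgue_measure)%E.

(** Measurability refers to the product sigma-algebra, so [U] is written as a countable union of
    squares with rational centre and radius. *)
Lemma open_measurable_plane {R : realType} (U : set (R * R)) :
  open U -> measurable U.
Proof.
move=> oU.
pose B (q : rat * rat * rat) : set (R * R) :=
  ball (ratr q.1.1 : R) (ratr q.2) `*` ball (ratr q.1.2 : R) (ratr q.2).
pose F n := if unpickle n is Some q then
  (if `[< B q `<=` U >] then B q else set0) else set0.
have -> : U = \bigcup_n F n.
  apply/seteqP; split=> [x Ux|x [n _]]; last first.
    rewrite /F; case: unpickle => [q|//].
    by case: asboolP => [BU /BU|].
  have /nbhs_ballP[e /= e0 eU] := open_nbhs_nbhs (conj oU Ux).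
  (* With radius below [e / 2], a rational square containing [x] stays within distance [e] of
     [x]. *)
  have [q /andP[q1 q2]] : exists q : rat, (0 : R) < ratr q < e / 2.
    have [q] := @rat_in_itvoo R 0 (e / 2) (divr_gt0 e0 (ltr0n _ 2)).
    by rewrite in_itv => h; exists q.
  have app (y : R) : exists p : rat, `|ratr p - y| < ratr q.
    have yq : y - ratr q < y + ratr q by lra.
    have [p] := @rat_in_itvoo R _ _ yq.
    rewrite in_itv /= => /andP[h1 h2]; exists p.
    by rewrite ltr_norml; apply/andP; split; lra.
  have [p1 hp1] := app x.1; have [p2 hp2] := app x.2.
  exists (pickle (p1, p2, q)); first exact: I.
  rewrite /F pickleK; case: asboolP => [_|].
    by split.
  case=> y [y1 y2]; apply: eU; split; rewrite -ball_normE /=.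
  - rewrite -ball_normE /= in y1.
    rewrite (_ : x.1 - y.1 = - (ratr p1 - x.1) + (ratr p1 - y.1)); last by ring.
    by rewrite (le_lt_trans (ler_normD _ _)) // normrN; lra.
  - rewrite -ball_normE /= in y2.
    rewrite (_ : x.2 - y.2 = - (ratr p2 - x.2) + (ratr p2 - y.2)); last by ring.
    by rewrite (le_lt_trans (ler_normD _ _)) // normrN; lra.
apply: bigcupT_measurable => n; rewrite /F; case: unpickle => [q|//].
by case: asboolP => // _; apply: measurableX; apply: open_measurable; exact: ball_open.
Qed.

Lemma affine_integral {R : realType} (s t p q : R) : s <= t ->
  (\int[lebesgue_measure]_(x in `[s, t]) (p + q * x)%:E =
   ((t - s) * ((p + q * s) + (p + q * t)) / 2)%:E)%E.
Proof.
rewrite le_eqVlt => /predU1P[->|st].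
  by rewrite set_itv1 integral_set1 subrr !mul0r.
pose F x := p * x + q / 2 * x ^+ 2.
have dF (x : R) : is_derive x 1 F (p + q * x).
  rewrite /F; apply: is_derive_eq.
  by rewrite /GRing.scale /=; field.
rewrite (@continuous_FTC2 _ _ F) //.
- by rewrite -EFinB /F; congr EFin; field.
- apply: continuous_subspaceT => x.
  by apply: cvgD; [exact: cvg_cst|apply: cvgM; [exact: cvg_cst|exact: cvg_id]].
- have cF : continuous F.
    move=> x; apply: differentiable_continuous; apply/derivable1_diffP.
    by have [] := dF x.
  split; first by move=> x _; have [] := dF x.
  + by apply: cvg_at_right_filter; exact: cF.
  + by apply: cvg_at_left_filter; exact: cF.
- by move=> x _; rewrite derive1E; have [_] := dF x.
Qed.

Lemma measurable_slab {R : realType} (s t : R) :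
  measurable [set x : R * R | s < x.1 < t].
Proof.
have -> : [set x : R * R | s < x.1 < t] = `]s, t[%classic `*` setT.
  by apply/seteqP; split=> x /=; rewrite in_itv /= => h; [split|case: h].
by apply: measurableX; [exact: measurable_itv|exact: measurableT].
Qed.

Lemma measurable_closed_slab {R : realType} (s t : R) :
  measurable [set x : R * R | s <= x.1 <= t].
Proof.
have -> : [set x : R * R | s <= x.1 <= t] = `[s, t]%classic `*` setT.
  by apply/seteqP; split=> x /=; rewrite in_itv /= => h; [split|case: h].
by apply: measurableX; [exact: measurable_itv|exact: measurableT].
Qed.

Lemma mu2U {R : realType} (A B : set (R * R)) : measurable A -> measurable B ->
  (forall x, A x -> ~ B x) -> mu2 (A `|` B) = (mu2 A + mu2 B)%E :> \bar R.
Proof.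
move=> mA mB AB; apply: (measureU mu2) => //.
by apply/seteqP; split=> // x [/AB].
Qed.

Lemma le_mu2 {R : realType} (A B : set (R * R)) : measurable A -> measurable B ->
  A `<=` B -> (mu2 A <= mu2 B :> \bar R)%E.
Proof. by move=> mA mB AB; apply: (le_measure mu2); rewrite ?inE. Qed.

Lemma mu2U_le {R : realType} (A B : set (R * R)) : measurable A -> measurable B ->
  (mu2 (A `|` B) <= mu2 A + mu2 B :> \bar R)%E.
Proof. by move=> mA mB; exact: (measureU2 mu2). Qed.

(** By Fubini: each vertical section of [U] over the slab contains an interval whose length is
    affine in [x]. Restricting to the open slab keeps the pieces on the two sides of a vertical line
    disjoint. *)
Lemma trapezoid_measure_ge {R : realType} (U : set (R * R)) (s t p q p' q' : R) :
  measurable U -> s <= t ->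
  (forall x, s < x < t -> p + q * x <= p' + q' * x) ->
  (forall x y, s < x < t -> p + q * x < y < p' + q' * x -> U (x, y)) ->
  (((t - s) * ((p' - p + (q' - q) * s) + (p' - p + (q' - q) * t)) / 2)%:E <=
   mu2 (U `&` [set x : R * R | s < x.1 < t]%R))%E.
Proof.
move=> mU st hl hU; rewrite -affine_integral //.
set V := U `&` _; have mV : measurable V.
  by apply: measurableI => //; exact: measurable_slab.
have ml : measurable_fun setT (fun x : R => (p' - p + (q' - q) * x)%:E).
  by apply/measurable_EFinP; apply: measurable_funD.
have mx : measurable_fun setT (lebesgue_measure \o xsection V).
  exact: measurable_fun_xsection.
rewrite (@integral_itv_bndoo _ s t _ true false); last exact: measurable_funTS.
apply: (@le_trans _ _ (\int[lebesgue_measure]_(x in `]s, t[)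
    (lebesgue_measure \o xsection V) x)%E); last first.
  by apply: ge0_subset_integral => //.
apply: ge0_le_integral => //.
- move=> x; rewrite /= in_itv /= => /hl h; rewrite lee_fin; lra.
- exact: measurable_funTS.
- exact: measurable_funTS.
- move=> x; rewrite /= in_itv /= => hx.
  have h := hl _ hx.
  apply: (@le_trans _ _ (lebesgue_measure `]p + q * x, p' + q' * x[%classic)).
    rewrite lebesgue_measure_itv /= lte_fin; case: ltP => h'.
      by rewrite -EFinB lee_fin; lra.
    by rewrite lee_fin; lra.
  apply: le_measure; rewrite ?inE //.
    exact: measurable_xsection.
  move=> y; rewrite /= in_itv /= => hy; apply/xsectionP.
  by split => //; exact: hU.
Qed.

Lemma trapezoid_measure_le {R : realType} (U : set (R * R)) (s t p q p' q' : R) :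
  measurable U -> s <= t ->
  (forall x, s < x < t -> p + q * x <= p' + q' * x) ->
  (forall x y, U (x, y) -> s <= x <= t) ->
  (forall x y, U (x, y) -> s < x < t -> p + q * x <= y <= p' + q' * x) ->
  (mu2 U <=
   ((t - s) * ((p' - p + (q' - q) * s) + (p' - p + (q' - q) * t)) / 2)%:E)%E.
Proof.
move=> mU st hl hs hU; rewrite -affine_integral //.
have ml : measurable_fun setT (fun x : R => (p' - p + (q' - q) * x)%:E).
  by apply/measurable_EFinP; apply: measurable_funD.
have mx : measurable_fun setT (lebesgue_measure \o xsection U).
  exact: measurable_fun_xsection.
have -> : mu2 U = (\int[lebesgue_measure]_(x in `[s, t])
    (lebesgue_measure \o xsection U) x)%E.
  rewrite [RHS]integral_mkcond; apply: eq_integral => x _.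
  rewrite patchE; case: ifPn => // /negP xst.
  rewrite /= (_ : xsection U x = set0) ?measure0 //.
  apply/seteqP; split => // y /xsectionP /hs h.
  by apply: xst; rewrite inE /= in_itv.
rewrite !(@integral_itv_bndoo _ s t _ true false); try exact: measurable_funTS.
apply: ge0_le_integral => //.
- exact: measurable_funTS.
- exact: measurable_funTS.
- move=> x; rewrite /= in_itv /= => hx.
  have h := hl _ hx.
  apply: (@le_trans _ _ (lebesgue_measure `[p + q * x, p' + q' * x]%classic)).
    apply: le_measure; rewrite ?inE //.
      exact: measurable_xsection.
    by move=> y /xsectionP /hU /(_ hx); rewrite /= in_itv.
  rewrite lebesgue_measure_itv /= lte_fin; case: ltP => h'.
    by rewrite -EFinB lee_fin; lra.
  by rewrite lee_fin; lra.
Qed.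

Definition mirror {R : realType} (x : R * R) : R * R := (x.1, - x.2).

Lemma mu2_mirror {R : realType} (U : set (R * R)) :
  measurable U -> mu2 (mirror @^-1` U) = mu2 U :> \bar R.
Proof.
move=> mU; apply: eq_integral => x _ /=.
rewrite -(@lebesgue_measureN _ (xsection U x)); last exact: measurable_xsection.
by congr lebesgue_measure; apply/seteqP; split=> y /xsectionP h; apply/xsectionP.
Qed.

(** Open triangles serve the lower bounds on area, where pieces must be disjoint; closed ones serve
    the upper bounds, where they must cover. *)
Definition open_triangle {R : realType} (a b c : R * R) : set (R * R) :=
  [set x | [/\ 0 < cross x b c, 0 < cross a x c & 0 < cross a b x]].

Definition closed_triangle {R : realType} (a b c : R * R) : set (R * R) :=
  [set x | [/\ 0 <= cross x b c, 0 <= cross a x c & 0 <= cross a b x]].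

Lemma cross_continuous {R : realType} {T : topologicalType} (f g h : T -> R * R) :
  continuous f -> continuous g -> continuous h ->
  continuous (fun t => cross (f t) (g t) (h t)).
Proof.
have c1 (k : T -> R * R) : continuous k -> continuous (fun t => (k t).1).
  by move=> ck t; apply: (@cvg_comp _ _ _ k fst); [exact: ck|exact: cvg_fst].
have c2 (k : T -> R * R) : continuous k -> continuous (fun t => (k t).2).
  by move=> ck t; apply: (@cvg_comp _ _ _ k snd); [exact: ck|exact: cvg_snd].
move=> cf cg ch t; apply: cvgB; apply: cvgM; apply: cvgB;
  by [exact: c1|exact: c2].
Qed.

Lemma measurable_open_triangle {R : realType} (a b c : R * R) :
  measurable (open_triangle a b c).
Proof.
have cc (y : R * R) : continuous (fun _ : R * R => y) by exact: cst_continuous.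
have ci : continuous (fun x : R * R => x) by move=> x; exact: cvg_id.
have op (f : R * R -> R) : continuous f -> open [set x | 0 < f x].
  by move=> /continuousP cf; apply: (cf [set y : R | 0 < y]); exact: open_gt.
have -> : open_triangle a b c = [set x | 0 < cross x b c] `&`
    [set x | 0 < cross a x c] `&` [set x | 0 < cross a b x].
  by apply/seteqP; split=> x [] // [].
by apply: open_measurable_plane; apply: openI; [apply: openI|]; apply: op;
  apply: cross_continuous.
Qed.

Lemma measurable_closed_triangle {R : realType} (a b c : R * R) :
  measurable (closed_triangle a b c).
Proof.
have cc (y : R * R) : continuous (fun _ : R * R => y) by exact: cst_continuous.
have ci : continuous (fun x : R * R => x) by move=> x; exact: cvg_id.
have op (f : R * R -> R) : continuous f -> measurable [set x | 0 <= f x].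
  move=> /continuousP cf; rewrite -[X in measurable X]setCK; apply: measurableC.
  apply: open_measurable_plane; rewrite (_ : ~` _ = [set x | f x < 0]).
    by apply: (cf [set y : R | y < 0]); exact: open_lt.
  by apply/seteqP; split=> x /=; rewrite ltNge => /negP.
have -> : closed_triangle a b c = [set x | 0 <= cross x b c] `&`
    [set x | 0 <= cross a x c] `&` [set x | 0 <= cross a b x].
  by apply/seteqP; split=> x [] // [].
by apply: measurableI; [apply: measurableI|]; apply: op;
  apply: cross_continuous.
Qed.

(* Rotating the vertices brings the leftmost one in front; the mirror image
   handles the case where the two others are then in the wrong order. *)
Lemma triangle_sort_ind {R : realType} (P : R * R -> R * R -> R * R -> Prop) :
  (forall a b c, P b c a -> P a b c) ->
  (forall a b c, P (mirror a) (mirror c) (mirror b) -> P a b c) ->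
  (forall a b c, a.1 <= b.1 -> b.1 <= c.1 -> P a b c) ->
  forall a b c, P a b c.
Proof.
move=> rot mir sorted.
have left_ (a b c : R * R) : a.1 <= b.1 -> a.1 <= c.1 -> P a b c.
  have [bc|/ltW cb] := leP b.1 c.1 => ab ac; first exact: sorted.
  by apply: mir; apply: sorted.
move=> a b c; have [ab|/ltW ba] := leP a.1 b.1; have [ac|/ltW ca] := leP a.1 c.1.
- exact: left_.
- by apply/rot/rot/left_ => //; exact: le_trans ab.
- by apply/rot/left_ => //; exact: le_trans ac.
- have [bc|/ltW cb] := leP b.1 c.1; first by apply/rot/left_.
  by apply/rot/rot/left_.
Qed.

(** The line through [P] and [Q] is [y = offset + slope * x]. On a vertical line the quotient
    defaults to 0, which is harmless: the slab over that side is then degenerate. *)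
Local Notation slope P Q := ((Q.2 - P.2) / (Q.1 - P.1)).
Local Notation offset P Q := (P.2 - slope P Q * P.1).

Lemma cross_line {R : realType} (p q : R * R) (x y : R) : p.1 < q.1 ->
  cross p q (x, y) = (q.1 - p.1) * (y - (offset p q + slope p q * x)).
Proof. by move=> pq; rewrite /cross /=; field; rewrite subr_eq0 gt_eqF. Qed.

Lemma cross_line_gt0 {R : realType} (p q : R * R) (x y : R) : p.1 < q.1 ->
  (0 < cross p q (x, y)) = (offset p q + slope p q * x < y).
Proof. by move=> pq; rewrite cross_line // pmulr_rgt0 subr_gt0. Qed.

Lemma cross_line_ge0 {R : realType} (p q : R * R) (x y : R) : p.1 < q.1 ->
  (0 <= cross p q (x, y)) = (offset p q + slope p q * x <= y).
Proof. by move=> pq; rewrite cross_line // -[RHS]subr_ge0 pmulr_rge0 // subr_gt0. Qed.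

Lemma cross_line_lt0 {R : realType} (p q : R * R) (x y : R) : p.1 < q.1 ->
  (0 < cross p (x, y) q) = (y < offset p q + slope p q * x).
Proof.
by move=> pq; rewrite cross_swap cross_line // oppr_gt0 -[RHS]subr_lt0 pmulr_rlt0 // subr_gt0.
Qed.

Lemma cross_line_le0 {R : realType} (p q : R * R) (x y : R) : p.1 < q.1 ->
  (0 <= cross p (x, y) q) = (y <= offset p q + slope p q * x).
Proof.
by move=> pq; rewrite cross_swap cross_line // oppr_ge0 -[RHS]subr_le0 pmulr_rle0 // subr_gt0.
Qed.

Section sorted.
Context {R : realType} (a b c : R * R).
Hypotheses (ab : a.1 <= b.1) (bc : b.1 <= c.1) (D0 : 0 < cross a b c).

Let ac : a.1 < c.1.
Proof.
rewrite lt_neqAle (le_trans ab bc) andbT; apply/negP => /eqP e.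
have e' : b.1 = a.1 by apply/eqP; rewrite eq_le {1}e bc ab.
by move: D0; rewrite /cross e' -e !subrr mul0r mulr0 subrr ltxx.
Qed.

(** Positive orientation puts [b] below the line [a c], so the vertical line through [b] cuts the
    triangle into two pieces with upper edge on [a c]. Their areas are proportional to their
    horizontal extents. *)
Let left_area : (b.1 - a.1) * ((offset a c - offset a b +
    (slope a c - slope a b) * a.1) + (offset a c - offset a b +
    (slope a c - slope a b) * b.1)) / 2 =
  (b.1 - a.1) / (c.1 - a.1) * (cross a b c / 2).
Proof.
have [e|ne] := eqVneq a.1 b.1; first by rewrite e subrr !mul0r.
by rewrite /cross; field; rewrite !subr_eq0 (gt_eqF ac) eq_sym ne.
Qed.

Let right_area : (c.1 - b.1) * ((offset a c - offset b c +
    (slope a c - slope b c) * b.1) + (offset a c - offset b c +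
    (slope a c - slope b c) * c.1)) / 2 =
  (c.1 - b.1) / (c.1 - a.1) * (cross a b c / 2).
Proof.
have [e|ne] := eqVneq b.1 c.1; first by rewrite e subrr !mul0r.
by rewrite /cross; field; rewrite !subr_eq0 (gt_eqF ac) eq_sym ne.
Qed.

Let left_le x : a.1 < x < b.1 ->
  offset a b + slope a b * x <= offset a c + slope a c * x.
Proof.
move=> /andP[ax xb]; have ab' := lt_trans ax xb.
rewrite -subr_ge0.
have -> : offset a c + slope a c * x - (offset a b + slope a b * x) =
    cross a b c * (x - a.1) / ((b.1 - a.1) * (c.1 - a.1)).
  by rewrite /cross; field; rewrite !subr_eq0 (gt_eqF ac) (gt_eqF ab').
by apply: ltW; apply: divr_gt0; apply: mulr_gt0 => //; rewrite subr_gt0.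
Qed.

Let right_le x : b.1 < x < c.1 ->
  offset b c + slope b c * x <= offset a c + slope a c * x.
Proof.
move=> /andP[bx xc]; have bc' := lt_trans bx xc.
rewrite -subr_ge0.
have -> : offset a c + slope a c * x - (offset b c + slope b c * x) =
    cross a b c * (c.1 - x) / ((c.1 - b.1) * (c.1 - a.1)).
  by rewrite /cross; field; rewrite !subr_eq0 (gt_eqF ac) (gt_eqF bc').
by apply: ltW; apply: divr_gt0; apply: mulr_gt0 => //; rewrite subr_gt0.
Qed.

Lemma open_triangle_sorted_ge :
  ((cross a b c / 2)%:E <= mu2 (open_triangle a b c))%E.
Proof.
have mU := measurable_open_triangle a b c.
pose V s t := open_triangle a b c `&` [set x : R * R | s < x.1 < t].
have mV s t : measurable (V s t) by exact: measurableI (measurable_slab _ _).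
have h1 : (((b.1 - a.1) / (c.1 - a.1) * (cross a b c / 2))%:E <=
    mu2 (V a.1 b.1))%E.
  rewrite -left_area; apply: trapezoid_measure_ge => // x y /andP[ax xb] /andP[h1 h2].
  have ab' := lt_trans ax xb.
  have fc : 0 < cross a b (x, y) by rewrite cross_line_gt0.
  split=> //; last by rewrite cross_line_lt0.
  (* Left of [b] the side [b c] imposes no further bound: its coordinate, scaled by [b.1 - a.1], is
     a positive term plus a nonnegative multiple of the coordinate of [a b]. *)
  rewrite -(pmulr_rgt0 _ (_ : 0 < b.1 - a.1)) ?subr_gt0 //.
  have -> : (b.1 - a.1) * cross (x, y) b c =
     cross a b c * (b.1 - x) + (c.1 - b.1) * cross a b (x, y).
    by rewrite /cross /=; ring.
  apply: ltr_wpDr; last by apply: mulr_gt0 => //; rewrite subr_gt0.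
  by apply: mulr_ge0; [rewrite subr_ge0|exact: ltW].
have h2 : (((c.1 - b.1) / (c.1 - a.1) * (cross a b c / 2))%:E <=
    mu2 (V b.1 c.1))%E.
  rewrite -right_area; apply: trapezoid_measure_ge => // x y /andP[bx xc] /andP[h2 h3].
  have bc' := lt_trans bx xc.
  have fa : 0 < cross (x, y) b c by rewrite cross_rot cross_line_gt0.
  split=> //; first by rewrite cross_line_lt0.
  rewrite -(pmulr_rgt0 _ (_ : 0 < c.1 - b.1)) ?subr_gt0 //.
  have -> : (c.1 - b.1) * cross a b (x, y) =
     cross a b c * (x - b.1) + (b.1 - a.1) * cross (x, y) b c.
    by rewrite /cross /=; ring.
  apply: ltr_wpDr; last by apply: mulr_gt0 => //; rewrite subr_gt0.
  by apply: mulr_ge0; [rewrite subr_ge0|exact: ltW].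
have -> : cross a b c / 2 = (b.1 - a.1) / (c.1 - a.1) * (cross a b c / 2) +
    (c.1 - b.1) / (c.1 - a.1) * (cross a b c / 2).
  by field; rewrite subr_eq0 gt_eqF.
rewrite EFinD; apply: (le_trans (leeD h1 h2)).
rewrite -mu2U //; last first.
  move=> x [_ /= /andP[_ xb]] [_ /= /andP[bx _]].
  by have := lt_trans xb bx; rewrite ltxx.
apply: le_mu2 => //; first exact: measurableU.
by move=> x [[]|[]].
Qed.

Lemma closed_triangle_sorted_le :
  (mu2 (closed_triangle a b c) <= (cross a b c / 2)%:E)%E.
Proof.
have mU := measurable_closed_triangle a b c.
set T := closed_triangle a b c in mU *.
have xle x y : T (x, y) -> a.1 <= x <= c.1.
  move=> [fa fb fc].
  (* The abscissa of a point of the triangle is the barycentric mean of those of the vertices, hence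
     lies between the extreme ones. *)
  have Ta : cross a b c * (x - a.1) =
      cross a (x, y) c * (b.1 - a.1) + cross a b (x, y) * (c.1 - a.1).
    by rewrite /cross /=; ring.
  have Tc : cross a b c * (c.1 - x) =
      cross (x, y) b c * (c.1 - a.1) + cross a (x, y) c * (c.1 - b.1).
    by rewrite /cross /=; ring.
  have ac' := ltW ac.
  rewrite -(subr_ge0 a.1 x) -(subr_ge0 x c.1).
  rewrite -(pmulr_rge0 (x - a.1) D0) -(pmulr_rge0 (c.1 - x) D0) Ta Tc.
  by apply/andP; split; apply: addr_ge0; apply: mulr_ge0 => //;
    rewrite subr_ge0.
pose V s t := T `&` [set x : R * R | s <= x.1 <= t].
have mV s t : measurable (V s t) by exact: measurableI (measurable_closed_slab _ _).
have h1 : (mu2 (V a.1 b.1) <=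
    ((b.1 - a.1) / (c.1 - a.1) * (cross a b c / 2))%:E)%E.
  rewrite -left_area; apply: trapezoid_measure_le => // [x y [] //|].
  move=> x y [[_ fb fc] _] /andP[ax xb]; have ab' := lt_trans ax xb.
  by rewrite -cross_line_ge0 // -cross_line_le0 // fc.
have h2 : (mu2 (V b.1 c.1) <=
    ((c.1 - b.1) / (c.1 - a.1) * (cross a b c / 2))%:E)%E.
  rewrite -right_area; apply: trapezoid_measure_le => // [x y [] //|].
  move=> x y [[fa fb _] _] /andP[bx xc]; have bc' := lt_trans bx xc.
  by rewrite -cross_line_ge0 // -cross_line_le0 // -cross_rot fa.
have -> : cross a b c / 2 = (b.1 - a.1) / (c.1 - a.1) * (cross a b c / 2) +
    (c.1 - b.1) / (c.1 - a.1) * (cross a b c / 2).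
  by field; rewrite subr_eq0 gt_eqF.
rewrite EFinD; apply: (le_trans _ (leeD h1 h2)).
apply: le_trans (mu2U_le _ _ (mV _ _) (mV _ _)).
apply: le_mu2 => //; first exact: measurableU.
move=> [x y] Txy; have /andP[ax xc] := xle _ _ Txy.
by have [xb|/ltW bx] := leP x b.1; [left|right]; split => //=; apply/andP.
Qed.
End sorted.

Lemma cross_mirror {R : realType} (a b c : R * R) :
  cross (mirror a) (mirror c) (mirror b) = cross a b c.
Proof. by rewrite /cross /=; ring. Qed.

(** For a nonpositive [cross] the bound holds because measures are nonnegative, so outer triangles
    that degenerate to a side are included. *)
Lemma open_triangle_ge {R : realType} (a b c : R * R) :
  ((cross a b c / 2)%:E <= mu2 (open_triangle a b c))%E.
Proof.
have [D0|D0] := leP (cross a b c) 0.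
  apply: (@le_trans _ _ 0%E); last exact: (measure_ge0 mu2).
  by rewrite lee_fin; lra.
move: a b c D0; apply: triangle_sort_ind.
- move=> a b c h; rewrite cross_rot => /h.
  suff -> : open_triangle b c a = open_triangle a b c by [].
  by apply/seteqP; split=> x; rewrite /open_triangle /= (cross_rot x b c)
    (cross_rot a x c) (cross_rot a b x) => -[? ? ?]; split.
- move=> a b c; rewrite cross_mirror => h /h.
  rewrite -mu2_mirror; last exact: measurable_open_triangle.
  set U := _ @^-1` _; suff -> : U = open_triangle a b c by [].
  by apply/seteqP; split=> x;
    rewrite /U /open_triangle /= !cross_mirror => -[? ? ?]; split.
- move=> a b c; exact: open_triangle_sorted_ge.
Qed.

Lemma closed_triangle_le {R : realType} (a b c : R * R) :
  0 < cross a b c ->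
  (mu2 (closed_triangle a b c) <= (cross a b c / 2)%:E)%E.
Proof.
move: a b c; apply: triangle_sort_ind.
- move=> a b c h; rewrite cross_rot => /h.
  suff -> : closed_triangle b c a = closed_triangle a b c by [].
  by apply/seteqP; split=> x; rewrite /closed_triangle /= (cross_rot x b c)
    (cross_rot a x c) (cross_rot a b x) => -[? ? ?]; split.
- move=> a b c; rewrite cross_mirror => h /h.
  rewrite -mu2_mirror; last exact: measurable_closed_triangle.
  set U := _ @^-1` _; suff -> : U = closed_triangle a b c by [].
  by apply/seteqP; split=> x;
    rewrite /U /closed_triangle /= !cross_mirror => -[? ? ?]; split.
- move=> a b c; exact: closed_triangle_sorted_le.
Qed.

(** * Pal's inequality *)

Lemma compact_measurable_plane {R : realType} (K : set (R * R)) :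
  compact K -> measurable K.
Proof.
move=> cK; rewrite -[K]setCK; apply: measurableC; apply: open_measurable_plane.
by apply: closed_openC; apply: compact_closed => //; exact: norm_hausdorff.
Qed.

(** A compact set lies in a square of finite measure, so [fine] loses nothing. *)
Lemma compact_area {R : realType} (K : set (R * R)) :
  compact K -> mu2 K = (area K)%:E.
Proof.
move=> cK; rewrite /area fineK // ge0_fin_numE; last exact: (measure_ge0 mu2).
have [M [_ hM]] := compact_bounded cK.
have {}hM x : K x -> `|x| <= `|M| + 1.
  by move=> Kx; apply: hM => //; rewrite (le_lt_trans (ler_norm _)) // ltrDl.
set N := `|M| + 1 in hM.
apply: (@le_lt_trans _ _ (mu2 (`[- N, N]%classic `*` `[- N, N]%classic))).
  apply: le_mu2; first exact: compact_measurable_plane.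
    by apply: measurableX; exact: measurable_itv.
  move=> x /hM; rewrite prod_normE ge_max => /andP[h1 h2].
  by split; rewrite /= in_itv /= -ler_norml.
rewrite product_measure1E; [|exact: measurable_itv|exact: measurable_itv].
rewrite /= lebesgue_measure_itv /=.
by case: ifP => _; rewrite ?mule0 ?ltry // -EFinB -EFinM ltry.
Qed.

Lemma interior_square {R : realType} (K : set (R * R)) (x : R * R) :
  K° x -> exists2 e : R, 0 < e &
    forall y : R * R, `|y.1 - x.1| < e -> `|y.2 - x.2| < e -> K y.
Proof.
move=> /nbhs_ballP[e /= e0 h]; exists e => // y y1 y2.
by apply: h; split; rewrite -ball_normE /= distrC.
Qed.

Lemma triangle_subset {R : realType} (K : set (R * R)) (a b c : R * R) :
  convex_set K -> K a -> K b -> K c -> triangle a b c `<=` K.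
Proof.
move=> cK Ka Kb Kc _ [r [s [t [r0 s0 t0 e ->]]]].
have [rs|rs] := eqVneq (r + s) 0.
  have -> : r = 0 by lra. have -> : s = 0 by lra. have -> : t = 1 by lra.
  by rewrite !scale0r scale1r !add0r.
have rs0 : 0 < r + s by rewrite lt_neqAle eq_sym rs addr_ge0.
have Km : K ((r / (r + s)) *: a + (1 - r / (r + s)) *: b).
  apply: convex_comb => //; first by rewrite divr_ge0 // ltW.
  by rewrite ler_pdivrMr //; lra.
have -> : r *: a + s *: b + t *: c =
    (r + s) *: ((r / (r + s)) *: a + (1 - r / (r + s)) *: b) + (1 - (r + s)) *: c.
  have -> : t = 1 - (r + s) by lra.
  by apply: pair_ext; rewrite !pairE; field.
by apply: convex_comb => //; lra.
Qed.

Lemma open_triangle_subset {R : realType} (K : set (R * R)) (a b c : R * R) :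
  convex_set K -> K a -> K b -> K c -> open_triangle a b c `<=` K.
Proof.
move=> cK Ka Kb Kc x [h1 h2 h3]; apply: (triangle_subset K a b c) => //.
apply/triangle_cross.
  by rewrite -(cross_split a b c x); apply: addr_gt0 => //; exact: addr_gt0.
by split; exact: ltW.
Qed.

(** [cross] is continuous on the compact set of triples of points of [K]. The maximum is positive
    because an interior square contains a right triangle with legs [e / 2]. *)
Lemma max_triangle {R : realType} (K : set (R * R)) : convex_body K ->
  exists a b c, [/\ K a, K b, K c, 0 < cross a b c &
    forall x y z, K x -> K y -> K z -> cross x y z <= cross a b c].
Proof.
move=> [cK _ [z0 /interior_square [e e0 he]]].
pose F (z : (R * R) * (R * R) * (R * R)) := cross z.1.1 z.1.2 z.2.
have e2 : `|e / 2| < e by rewrite gtr0_norm //; lra.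
have Ko : K z0 by apply: he; rewrite subrr normr0.
have K1 : K (z0.1 + e / 2, z0.2).
  by apply: he => /=; rewrite ?subrr ?normr0 // addrAC subrr add0r.
have K2 : K (z0.1, z0.2 + e / 2).
  by apply: he => /=; rewrite ?subrr ?normr0 // addrAC subrr add0r.
have cF : {within (K `*` K) `*` K, continuous F}.
  apply: continuous_subspaceT; apply: cross_continuous => t.
  - by apply: (@cvg_comp _ _ _ fst fst); exact: cvg_fst.
  - by apply: (@cvg_comp _ _ _ fst snd); [exact: cvg_fst|exact: cvg_snd].
  - exact: cvg_snd.
have [|[[a b] c] abcK hmax] := compact_EVT_max _ (compact_setX (compact_setX cK cK) cK) cF.
  by exists (z0, z0, z0).
have [[Ka Kb] Kc] : ((K `*` K) `*` K) (a, b, c) by move: abcK; rewrite inE.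
have hm x y z : K x -> K y -> K z -> cross x y z <= cross a b c.
  by move=> Kx Ky Kz; apply: (hmax (x, y, z)); rewrite inE.
exists a, b, c; split=> //; apply: lt_le_trans (hm _ _ _ Ko K1 K2).
have -> : cross z0 (z0.1 + e / 2, z0.2) (z0.1, z0.2 + e / 2) = e / 2 * (e / 2).
  by rewrite /cross /=; ring.
by rewrite mulr_gt0 // divr_gt0.
Qed.

Lemma cross_min {R : realType} (K : set (R * R)) (b c : R * R) :
  compact K -> K !=set0 ->
  exists2 p, K p & forall x, K x -> cross p b c <= cross x b c.
Proof.
move=> cK K0.
have cF : {within K, continuous (fun x => cross x b c)}.
  apply: continuous_subspaceT; apply: cross_continuous => t.
  - exact: cvg_id.
  - exact: cvg_cst.
  - exact: cvg_cst.
have [p pK h] := compact_EVT_min K0 cK cF.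
by exists p => [|x Kx]; [move: pK; rewrite inE|apply: h; rewrite inE].
Qed.

(* The three outer triangles are erected on the sides of a triangle of maximal
   area; they do not overlap because no point of [K] is farther from a side than
   the opposite vertex. *)
Lemma area_max_triangle {R : realType} (K : set (R * R)) (a b c p q r : R * R) :
  compact K -> convex_set K -> K a -> K b -> K c -> K p -> K q -> K r ->
  (forall x y z, K x -> K y -> K z -> cross x y z <= cross a b c) ->
  (cross a b c - cross p b c - cross q c a - cross r a b) / 2 <= area K.
Proof.
move=> cK vK Ka Kb Kc Kp Kq Kr hmax.
rewrite -lee_fin -compact_area //.
have mK := compact_measurable_plane _ cK.
(* The sides are reversed in the outer triangles, since the extreme points lie on their other
   side. *)
pose T0 := open_triangle a b c; pose T1 := open_triangle p c b.
pose T2 := open_triangle q a c; pose T3 := open_triangle r b a.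
have m0 : measurable T0 by exact: measurable_open_triangle.
have m1 : measurable T1 by exact: measurable_open_triangle.
have m2 : measurable T2 by exact: measurable_open_triangle.
have m3 : measurable T3 by exact: measurable_open_triangle.
have s0 : T0 `<=` K by exact: open_triangle_subset.
have s1 : T1 `<=` K by exact: open_triangle_subset.
have s2 : T2 `<=` K by exact: open_triangle_subset.
have s3 : T3 `<=` K by exact: open_triangle_subset.
have f1 x : T1 x -> cross x b c < 0 by move=> [h _ _]; rewrite cross_swap oppr_lt0.
have f2 x : T2 x -> cross x c a < 0 by move=> [h _ _]; rewrite cross_swap oppr_lt0.
have f3 x : T3 x -> cross x a b < 0 by move=> [h _ _]; rewrite cross_swap oppr_lt0.
have fs x : cross x b c + cross x c a + cross x a b = cross a b c.
  by rewrite -(cross_split a b c x) (cross_rot a x c) -(cross_rot x a b).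
have fK x : K x -> [/\ cross x b c <= cross a b c, cross x c a <= cross a b c &
    cross x a b <= cross a b c] by move=> Kx; split; exact: hmax.
have d01 x : T0 x -> ~ T1 x by move=> [h _ _] /f1; lra.
have d02 x : T0 x -> ~ T2 x by move=> [_ h _] /f2; move: h; rewrite cross_rot; lra.
have d03 x : T0 x -> ~ T3 x.
  by move=> [_ _ h] /f3; move: h; rewrite -cross_rot; lra.
(* A point beyond two sides has two negative coordinates; as the three sum to [cross a b c], the
   third would exceed it, against maximality. *)
have d12 x : T1 x -> ~ T2 x.
  by move=> t1 t2; have [_ _ h] := fK _ (s1 _ t1); move: h (fs x) (f1 _ t1) (f2 _ t2); lra.
have d13 x : T1 x -> ~ T3 x.
  by move=> t1 t2; have [_ h _] := fK _ (s1 _ t1); move: h (fs x) (f1 _ t1) (f3 _ t2); lra.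
have d23 x : T2 x -> ~ T3 x.
  by move=> t1 t2; have [h _ _] := fK _ (s2 _ t1); move: h (fs x) (f2 _ t1) (f3 _ t2); lra.
have -> : (cross a b c - cross p b c - cross q c a - cross r a b) / 2 =
    cross a b c / 2 + cross p c b / 2 + cross q a c / 2 + cross r b a / 2.
  by rewrite (cross_swap p b c) (cross_swap q c a) (cross_swap r a b); field.
rewrite !EFinD.
apply: (@le_trans _ _ (mu2 T0 + mu2 T1 + mu2 T2 + mu2 T3)%E).
  by apply: leeD; [apply: leeD; [apply: leeD|]|]; exact: open_triangle_ge.
rewrite -mu2U // -mu2U //; [|exact: measurableU|by move=> x [/d02|/d12]].
rewrite -mu2U //; [|by do 2 (apply: measurableU => //)|by move=> x [[/d03|/d13]|/d23]].
apply: le_mu2 => //; first by do 3 (apply: measurableU => //).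
by move=> x [[[/s0|/s1]|/s2]|/s3].
Qed.

Lemma pal_inequality {R : realType} (K : set (R * R)) : convex_body K ->
  width K ^+ 2 / Num.sqrt 3 <= area K /\
  (width K ^+ 2 / Num.sqrt 3 = area K -> 0 < width K -> equilateral_triangle K).
Proof.
move=> hK; have [a [b [c [Ka Kb Kc D0 hmax]]]] := max_triangle K hK.
have [cK vK _] := hK.
have K0 : K !=set0 by exists a.
have [p Kp hp] := cross_min K b c cK K0.
have [q Kq hq] := cross_min K c a cK K0.
have [r Kr hr] := cross_min K a b cK K0.
have areaK := area_max_triangle K a b c p q r cK vK Ka Kb Kc Kp Kq Kr hmax.
set D := cross a b c in D0 hmax areaK.
have Dn0 : D != 0 by rewrite gt_eqF.
have fs x : cross x b c + cross x c a + cross x a b = D.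
  by rewrite /D -(cross_split a b c x) (cross_rot a x c) -(cross_rot x a b).
have tri0 (x y : R * R) : cross x y x = 0 /\ cross x x y = 0.
  by rewrite /cross; split; ring.
have bnd x y z : K x -> K y -> K z -> - D <= cross x y z <= D.
  move=> Kx Ky Kz; rewrite hmax // andbT.
  by have := hmax _ _ _ Kx Kz Ky; rewrite cross_swap; lra.
have p0 : cross p b c <= 0 by apply: (le_trans (hp _ Kb)); rewrite (tri0 b c).2.
have q0 : cross q c a <= 0 by apply: (le_trans (hq _ Kc)); rewrite (tri0 c a).2.
have r0 : cross r a b <= 0 by apply: (le_trans (hr _ Ka)); rewrite (tri0 a b).2.
pose b1 := - cross p b c / D; pose b2 := - cross q c a / D.
pose b3 := - cross r a b / D.
have be (s : R) : s <= 0 -> - D <= s <= D -> 0 <= - s / D <= 1.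
  move=> s0 /andP[s1 _]; rewrite divr_ge0 ?oppr_ge0 ?(ltW D0) //=.
  by rewrite ler_pdivrMr // mul1r; lra.
have hb1 : 0 <= b1 <= 1 by apply: be => //; exact: bnd.
have hb2 : 0 <= b2 <= 1 by apply: be => //; exact: bnd.
have hb3 : 0 <= b3 <= 1 by apply: be => //; exact: bnd.
have w0 := width_ge0 K.
have wd (x y z : R * R) : K x -> K y -> (forall t, K t -> cross z x y <= cross t x y) ->
    width K ^+ 2 * dist x y ^+ 2 <= (D * (1 + - cross z x y / D)) ^+ 2.
  move=> Kx Ky hz; rewrite -exprMn.
  have h : width K * dist x y <= D - cross z x y.
    by apply: width_dist_le => // t Kt; rewrite hz // hmax.
  have -> : D * (1 + - cross z x y / D) = D - cross z x y by field.
  by rewrite lerXn2r // nnegrE ?mulr_ge0 ?dist_ge0 // (le_trans _ h) // mulr_ge0 ?dist_ge0.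
have w1 := wd _ _ _ Kb Kc hp; have w2 := wd _ _ _ Kc Ka hq.
have w3 := wd _ _ _ Ka Kb hr.
have hL := weitzenbock a b c.
set E := 2 * (_ + _) in hL.
have E0 : 0 <= E by rewrite mulr_ge0 // addr_ge0 // sqr_ge0.
have hL' : dist b c ^+ 2 + dist c a ^+ 2 + dist a b ^+ 2 = 2 * Num.sqrt 3 * D + E.
  by rewrite -hL; ring.
have [le_w eq_w] := pal_arith _ _ _ _ _ _ _ _ _ w0 D0 E0 hb1 hb2 hb3 w1 w2 w3 hL'.
have eA : (D - cross p b c - cross q c a - cross r a b) / 2 =
    D / 2 * (1 + b1 + b2 + b3) by rewrite /b1 /b2 /b3; field.
rewrite eA in areaK.
split; first exact: le_trans areaK.
move=> eq_area wpos.
have [|//|Ez [z1 z2 z3] [l1 l2 l3]] := eq_w.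
  by apply/eqP; rewrite eq_le le_w eq_area.
have [e1 e2] : dist a b = dist b c /\ dist b c = dist c a.
  by apply: weitzenbock_eq; rewrite hL Ez addr0.
have bb (u v : R) : 0 <= u <= 1 -> 0 <= v <= 1 -> (D * (1 + u)) ^+ 2 = (D * (1 + v)) ^+ 2 ->
    u = v.
  move=> /andP[u0 _] /andP[v0 _] /eqP.
  have pos t : 0 <= t -> 0 <= D * (1 + t).
    by move=> t0; apply: mulr_ge0; [exact: ltW|exact: addr_ge0].
  by rewrite eqrXn2 ?pos // (inj_eq (mulfI Dn0)) => /eqP /addrI.
(* Equal sides make the three equalities [w^2 L = (D (1 + b))^2] share their left side, so the [b]
   agree. *)
have b12 : b1 = b2 by apply: bb => //; rewrite -l1 -l2 e2.
have b23 : b2 = b3 by apply: bb => //; rewrite -l2 -l3 -e2 e1.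
have [b10|b1n0] := eqVneq b1 0; last first.
  have b11 : b1 = 1.
    by apply: (mulfI b1n0); rewrite mulr1 -expr2.
  have fE (s : R) : - s / D = 1 -> s = - D.
    by move=> h; apply: oppr_inj; rewrite opprK -[RHS]mul1r -h divfK.
  have pe : cross p b c = - D by apply: fE.
  have qe : cross q c a = - D by apply: fE; rewrite -b11 b12.
  have re : cross r a b = - D by apply: fE; rewrite -b11 b12 b23.
  (* The three coordinates sum to [D] and none exceeds [D]; if one is [- D], the other two equal
     [D], which determines the point. *)
  have aff (x y z t : R * R) : cross y z t = D -> K y -> K z -> K t -> K x ->
      cross x z t = - D -> x = - y + z + t.
    move=> ye Ky Kz Kt Kx xe.
    have /andP[_ h1] := bnd _ _ _ Ky Kx Kt; have /andP[_ h2] := bnd _ _ _ Ky Kz Kx.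
    have h3 := cross_split y z t x.
    rewrite (cross_barycenter y z t x) ye // xe.
    have -> : cross y x t = D by lra.
    have -> : cross y z x = D by lra.
    by rewrite mulNr divff // scaleN1r !scale1r.
  have pE : p = - a + b + c by apply: aff.
  have qE : q = - b + c + a by apply: aff => //; rewrite /D [RHS]cross_rot.
  have rE : r = - c + a + b.
    by apply: aff => //; rewrite /D [RHS]cross_rot [RHS]cross_rot.
  (* The points [p], [q], [r] span the triangle whose side midpoints are [a], [b], [c]; its area is
     four times larger, against maximality. *)
  have := hmax _ _ _ Kp Kq Kr.
  have -> : cross p q r = 4 * D.
    by rewrite pE qE rE /D /cross !pairE; ring.
  by move: D0; lra.
have fz (s : R) : - s / D = 0 -> s = 0.
  by move=> /eqP; rewrite mulf_eq0 invr_eq0 (negbTE Dn0) orbF oppr_eq0 => /eqP.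
exists a, b, c; split=> //.
  rewrite lt_neqAle dist_ge0 andbT eq_sym; apply/negP => /eqP d0.
  move: l3; rewrite d0 -b23 -b12 b10 expr0n /= mulr0 addr0 mulr1 => /esym/eqP.
  by rewrite sqrf_eq0 (negbTE Dn0).
apply/seteqP; split; last exact: triangle_subset.
move=> x Kx; apply/triangle_cross => //; split.
- by rewrite -(fz (cross p b c)) ?hp.
- by rewrite cross_rot -(fz (cross q c a)) ?hq // -b10 b12.
- by rewrite -cross_rot -(fz (cross r a b)) ?hr // -b10 b12 b23.
Qed.

(** * Bisection by a chord *)

Lemma square_interior {R : realType} (K : set (R * R)) (x : R * R) (e : R) :
  0 < e -> (forall y : R * R, `|y.1 - x.1| < e -> `|y.2 - x.2| < e -> K y) ->
  K° x.
Proof.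
move=> e0 h; apply/nbhs_ballP; exists e => // y [].
by rewrite -!ball_normE /= => h1 h2; apply: h; rewrite distrC.
Qed.

(** A square around [x] inside [K], shrunk by the factor [s] towards [y], stays in [K] by convexity
    and surrounds the combination. *)
Lemma interior_comb {R : realType} (K : set (R * R)) (x y : R * R) (s : R) :
  convex_set K -> K° x -> K y -> 0 < s -> s <= 1 ->
  K° (s *: x + (1 - s) *: y).
Proof.
move=> vK /interior_square[e e0 he] Ky s0 s1.
apply: (@square_interior _ _ _ (s * e)); first exact: mulr_gt0.
move=> z h1 h2; set d := z - (s *: x + (1 - s) *: y).
have -> : z = s *: (x + s^-1 *: d) + (1 - s) *: y.
  by apply: pair_ext; rewrite /d !pairE; field; rewrite gt_eqF.
apply: convex_comb => //; last exact: ltW.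
have small (r : R) : `|r| < s * e -> `|s^-1 * r| < e.
  move=> hr; rewrite normrM gtr0_norm ?invr_gt0 // -(ltr_pM2l s0) mulrA.
  by rewrite divff ?mul1r // gt_eqF.
by apply: he; rewrite !pairE addrAC subrr add0r small.
Qed.

Lemma interior_move {R : realType} (K : set (R * R)) (x v : R * R) : K° x ->
  exists2 d : R, 0 < d & K (x + d *: v) /\ K (x - d *: v).
Proof.
move=> /interior_square[e e0 he].
have N0 : 0 < `|v.1| + `|v.2| + 1 by rewrite ltr_wpDl // addr_ge0.
have small (r : R) : `|r| < `|v.1| + `|v.2| + 1 ->
    `|e / (`|v.1| + `|v.2| + 1) * r| < e.
  move=> h; rewrite normrM gtr0_norm ?divr_gt0 // mulrAC ltr_pdivrMr //.
  by rewrite ltr_pM2l.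
have v1 : `|v.1| < `|v.1| + `|v.2| + 1 by have := normr_ge0 v.2; lra.
have v2 : `|v.2| < `|v.1| + `|v.2| + 1 by have := normr_ge0 v.1; lra.
exists (e / (`|v.1| + `|v.2| + 1)); first exact: divr_gt0.
by split; apply: he; rewrite !pairE addrAC subrr add0r ?normrN small.
Qed.

Lemma dotp_continuous {R : realType} (u : R * R) : continuous (dotp u).
Proof.
move=> x; apply: cvgD; apply: cvgM; try exact: cvg_cst;
  [exact: cvg_fst|exact: cvg_snd].
Qed.

Lemma dotp_closed {R : realType} (u : R * R) (F : set R) :
  closed F -> closed (dotp u @^-1` F).
Proof. by move=> cF; apply: closed_comp cF => x _; exact: dotp_continuous. Qed.

Lemma dotp_extrema {R : realType} (K : set (R * R)) (u : R * R) :
  compact K -> K !=set0 ->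
  exists x y, [/\ K x, K y & forall z, K z -> dotp u x <= dotp u z <= dotp u y].
Proof.
move=> cK K0.
have cu := continuous_subspaceT (A := K) (@dotp_continuous R u).
have [x xK hx] := compact_EVT_min K0 cK cu.
have [y yK hy] := compact_EVT_max K0 cK cu.
exists x, y; split; [by rewrite inE in xK|by rewrite inE in yK|move=> z Kz].
by rewrite hx ?inE // hy ?inE.
Qed.

Lemma width_setI_le {R : realType} (K : set (R * R)) (u : R * R) (f : R * R -> Prop)
    (a b : R) : dotp u u = 1 -> a <= b ->
  (forall x, K x -> f x -> a <= dotp u x <= b) ->
  width (K `&` f) <= b - a.
Proof. by move=> u1 ab h; apply: (@width_le _ _ u); split=> // x []; exact: h. Qed.

Lemma dotpNr {R : realType} (u x : R * R) : dotp u (- x) = - dotp u x.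
Proof. by rewrite /dotp !pairE; ring. Qed.

Definition perp {R : realType} (u : R * R) : R * R := (- u.2, u.1).

Lemma dotp_perp {R : realType} (u : R * R) : dotp u (perp u) = 0.
Proof. by rewrite /dotp /=; ring. Qed.

Lemma perp_eq {R : realType} (u x y : R * R) : dotp u u = 1 ->
  dotp u x = dotp u y -> dotp (perp u) x = dotp (perp u) y -> x = y.
Proof.
move=> u1.
have dec z : z = dotp u z *: u + dotp (perp u) z *: perp u.
  apply: pair_ext; rewrite !pairE -[LHS]mul1r -u1 /dotp /=; ring.
by move=> h1 h2; rewrite (dec x) (dec y) h1 h2.
Qed.

(** Parametrised so that [y] is reached at [-1] and [z] at [1]. *)
Definition segment {R : realType} (y z : R * R) (t : R) : R * R :=
  ((1 - t) / 2) *: y + (1 - (1 - t) / 2) *: z.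

Lemma dotp_segment {R : realType} (v y z : R * R) (t : R) :
  dotp v (segment y z t) =
  (dotp v y + dotp v z) / 2 + (dotp v z - dotp v y) / 2 * t.
Proof. by rewrite /segment dotpDr !dotpZr; field. Qed.

Lemma segment_continuous {R : realType} (y z : R * R) : continuous (segment y z).
Proof.
have ca (p q : R) : continuous (fun t : R => p + q * t).
  move=> t; apply: cvgD; first exact: cvg_cst.
  by apply: cvgM; [exact: cvg_cst|exact: cvg_id].
have -> : segment y z = fun t => ((y.1 + z.1) / 2 + (z.1 - y.1) / 2 * t,
                                  (y.2 + z.2) / 2 + (z.2 - y.2) / 2 * t).
  by apply/funext => t; apply: pair_ext; rewrite /segment !pairE /=; field.
by move=> t; exact: (cvg_pair (ca _ _ t) (ca _ _ t)).
Qed.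

(** An interior point moved towards the extreme point beyond the level [m] crosses that level while
    still interior. *)
Lemma interior_level {R : realType} (K : set (R * R)) (u x y : R * R) (m : R) :
  convex_set K -> K° !=set0 -> K x -> K y -> dotp u u = 1 ->
  (forall z, K z -> dotp u x <= dotp u z <= dotp u y) ->
  m = (dotp u x + dotp u y) / 2 ->
  dotp u x < dotp u y /\ exists2 c, K° c & dotp u c = m.
Proof.
move=> vK [z0 Kz0] Kx Ky u1 hK em.
have [d d0 [Kp Km]] := interior_move _ _ u Kz0.
have /andP[_ zy] := hK _ Kp; have /andP[xz _] := hK _ Km.
move: zy xz; rewrite !dotpDr dotpNr !dotpZr u1 mulr1 => zy xz.
split; first by lra.
have [zm|mz] := leP (dotp u z0) m.
- exists (((dotp u y - m) / (dotp u y - dotp u z0)) *: z0 +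
          (1 - (dotp u y - m) / (dotp u y - dotp u z0)) *: y).
    apply: interior_comb => //; first by apply: divr_gt0; lra.
    by rewrite ler_pdivrMr; lra.
  rewrite dotpDr !dotpZr; field; lra.
- exists (((m - dotp u x) / (dotp u z0 - dotp u x)) *: z0 +
          (1 - (m - dotp u x) / (dotp u z0 - dotp u x)) *: x).
    apply: interior_comb => //; first by apply: divr_gt0; lra.
    by rewrite ler_pdivrMr; lra.
  rewrite dotpDr !dotpZr; field; lra.
Qed.

(** The section of [K] by the line is a segment, with ends extremal along the line. The ends are not
    interior, since an interior point could be moved further along the line. Every other point is a
    combination of the interior point [c] with an end, hence interior. *)
Lemma chord_bisecting_curve {R : realType} (K : set (R * R)) (u c : R * R) (m : R) :
  compact K -> convex_set K -> dotp u u = 1 -> K° c -> dotp u c = m ->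
  exists2 l, bisecting_curve K l &
    K `&` [set x | dotp u x = m] = l @` `[-1, 1]%classic.
Proof.
move=> cK vK u1 ic cm.
have Kc : K c := interior_subset ic.
set C := K `&` _.
have cC : compact C.
  apply: compact_closedI => //.
  rewrite (_ : [set x | _] = dotp u @^-1` [set m]) //.
  by apply: dotp_closed; exact: closed_eq.
have Cc : C c by [].
pose v := perp u.
have [y [z [[Ky uy] [Kz uz] hC]]] := dotp_extrema C v cC (ex_intro _ c Cc).
have vv : dotp v v = 1 by rewrite -u1 /dotp /v /=; ring.
have uv : dotp u v = 0 by exact: dotp_perp.
have CK x t : C x -> K (x + t *: v) -> C (x + t *: v).
  by move=> [_ ux] Kt; split=> //=; rewrite dotpDr dotpZr uv mulr0 addr0.
have inner x : C x -> K° x -> dotp v y < dotp v x < dotp v z.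
  move=> Cx /(interior_move _ _ v)[d d0 [Kp Km]].
  have /andP[_ h1] := hC _ (CK _ _ Cx Kp).
  rewrite -scaleNr in Km.
  have /andP[h2 _] := hC _ (CK _ _ Cx Km).
  by move: h1 h2; rewrite !dotpDr !dotpZr vv !mulr1 => h1 h2; apply/andP; split; lra.
have /andP[yc cz] := inner c Cc ic.
have comb x (w : R * R) (s : R) : C x -> C w -> dotp v x = s * dotp v c + (1 - s) * dotp v w ->
    x = s *: c + (1 - s) *: w.
  move=> [_ ux] [_ uw] e; apply: (perp_eq u) => //.
    by rewrite dotpDr !dotpZr cm uw ux; ring.
  by rewrite dotpDr !dotpZr e.
have outer x : C x -> dotp v y < dotp v x < dotp v z -> K° x.
  move=> Cx /andP[yx xz].
  have [xc|cx] := leP (dotp v x) (dotp v c).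
    rewrite (comb x y ((dotp v x - dotp v y) / (dotp v c - dotp v y))) //; last first.
      by field; lra.
    apply: interior_comb => //; first by apply: divr_gt0; lra.
    by rewrite ler_pdivrMr; lra.
  rewrite (comb x z ((dotp v z - dotp v x) / (dotp v z - dotp v c))) //; last first.
    by field; lra.
  apply: interior_comb => //; first by apply: divr_gt0; lra.
  by rewrite ler_pdivrMr; lra.
have yz : 0 < dotp v z - dotp v y by lra.
have Cl t : t \in `[-1, 1] -> C (segment y z t).
  rewrite in_itv /= => /andP[t1 t2]; split; last first.
    by rewrite /= dotp_segment uy uz; field.
  by apply: convex_comb => //; lra.
exists (segment y z).
  split.
  - by apply: continuous_subspaceT; exact: segment_continuous.
  - move=> s t _ _ /(congr1 (dotp v)); rewrite !dotp_segment => /addrI.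
    by apply: mulfI; rewrite gt_eqF // divr_gt0.
  - by move=> _ [t tI <-]; have [] := Cl t tI.
  - move=> t tI; have Ct := Cl t tI.
    have := tI; rewrite in_itv /= => /andP[t1 t2]; split.
      move=> [_ nint]; apply: contrapT => ne; apply: nint; apply: outer => //.
      have tl : -1 < t.
        by rewrite lt_neqAle t1 andbT eq_sym; apply/eqP => e; apply: ne; left.
      have tr : t < 1.
        by rewrite lt_neqAle t2 andbT; apply/eqP => e; apply: ne; right.
      by rewrite dotp_segment; apply/andP; split; nra.
    move=> te; split; first by apply: subset_closure; exact: Ct.1.
    move=> /(inner _ Ct); rewrite dotp_segment.
    by case: te => ->; move=> /andP[]; lra.
apply/seteqP; split; last by move=> _ [t tI <-]; exact: Cl.
move=> x Cx; have /andP[yx xz] := hC _ Cx.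
exists (2 * (dotp v x - dotp v y) / (dotp v z - dotp v y) - 1).
  rewrite /= in_itv /=; apply/andP; split.
    by rewrite lerBrDr addNr divr_ge0 //; lra.
  by rewrite lerBlDr ler_pdivrMr //; lra.
apply: (perp_eq u) => //.
  by rewrite dotp_segment uy uz Cx.2; field; rewrite gt_eqF.
by rewrite dotp_segment; field; rewrite gt_eqF.
Qed.

Lemma middle_bisection {R : realType} (K : set (R * R)) (u : R * R) (a b : R) :
  convex_body K -> between_lines K u a b ->
  exists K1 K2, bisection K K1 K2 /\ Num.max (width K1) (width K2) <= (b - a) / 2.
Proof.
move=> [cK vK iK] [u1 _ hab].
have K0 : K !=set0 by have [z /interior_subset] := iK; exists z.
have [x [y [Kx Ky hK]]] := dotp_extrema K u cK K0.
(* The middle of the projection of [K] rather than of the given strip: in a strip that is too wide,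
   the middle line could miss [K]. *)
set m := (dotp u x + dotp u y) / 2.
have [xy [c ic cm]] := interior_level K u x y m vK iK Kx Ky u1 hK erefl.
have [l lK lC] := chord_bisecting_curve K u c m cK vK u1 ic cm.
have /andP[ax _] := hab _ Kx; have /andP[_ yb] := hab _ Ky.
have clK : closed K by apply: compact_closed => //; exact: norm_hausdorff.
exists (K `&` dotp u @^-1` [set t | t <= m]), (K `&` dotp u @^-1` [set t | m <= t]).
split; last first.
  rewrite ge_max; apply/andP; split.
    apply: (@le_trans _ _ (m - dotp u x)); last by rewrite /m; lra.
    apply: (width_setI_le K u) => //; first by rewrite /m; lra.
    by move=> z /hK /andP[h1 _] h2; rewrite h1.
  apply: (@le_trans _ _ (dotp u y - m)); last by rewrite /m; lra.
  apply: (width_setI_le K u) => //; first by rewrite /m; lra.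
  by move=> z /hK /andP[_ h1] h2; rewrite h1 andbT.
split.
- by apply: closedI => //; apply: dotp_closed; exact: closed_le.
- by apply: closedI => //; apply: dotp_closed; exact: closed_ge.
- apply/seteqP; split=> [z Kz|z [[]|[]] //].
  by have [h|/ltW h] := leP (dotp u z) m; [left|right].
- exists l => //; rewrite -lC; apply/seteqP; split=> z.
    by move=> [[Kz h1] [_ h2]]; split=> //; apply/le_anti/andP.
  by move=> [Kz /= h]; split; split=> //; rewrite /preimage /= h.
Qed.

(** * The bisecting width *)

(** Guards against the default value 0 of [inf] on the empty set; it applies to [K] and to the
    pieces of a bisection. *)
Lemma compact_strip {R : realType} (K S : set (R * R)) :
  compact K -> S `<=` K ->
  [set d : R | exists u a b, between_lines S u a b /\ d = b - a] !=set0.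
Proof.
move=> cK SK; pose u : R * R := (1, 0).
have [[x0 Kx0]|K0] := pselect (K !=set0).
  have [x [y [_ _ h]]] := dotp_extrema K u cK (ex_intro _ _ Kx0).
  exists (dotp u y - dotp u x), u, (dotp u x), (dotp u y); split=> //; split.
  - by rewrite /dotp /=; ring.
  - by have /andP[] := h _ Kx0; exact: le_trans.
  - by move=> z /SK /h.
exists (0 - 0), u, 0, 0; split=> //; split=> //.
  by rewrite /dotp /=; ring.
by move=> z /SK Kz; case: K0; exists z.
Qed.

(** If both widths were below [H / 2], strips narrower than [H / 2] around the two pieces would
    cover the triangle, against [equilateral_planks]. *)
Lemma bisection_width_ge {R : realType} (K K1 K2 : set (R * R)) (a b c : R * R) (H : R) :
  0 < dist a b -> dist a b = dist b c -> dist b c = dist c a ->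
  H ^+ 2 = 3 / 4 * dist a b ^+ 2 -> triangle a b c `<=` K -> compact K ->
  bisection K K1 K2 -> H / 2 <= Num.max (width K1) (width K2).
Proof.
move=> d0 e1 e2 eH TK cK [_ _ KE _].
rewrite leNgt; apply/negP; rewrite gt_max => /andP[w1 w2].
have s1 : K1 `<=` K by rewrite KE; exact: subsetUl.
have s2 : K2 `<=` K by rewrite KE; exact: subsetUr.
have [_ [u1 [a1 [b1 [l1 ->]]]] h1] := inf_lt (compact_strip _ _ cK s1) w1.
have [_ [u2 [a2 [b2 [l2 ->]]]] h2] := inf_lt (compact_strip _ _ cK s2) w2.
have TU : triangle a b c `<=` K1 `|` K2 by rewrite -KE.
have := equilateral_planks _ _ _ _ _ _ _ _ _ _ _ _ d0 e1 e2 eH TU l1 l2.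
by rewrite leNgt gt_max h1 h2.
Qed.

Lemma bisecting_width_le {R : realType} (K : set (R * R)) :
  convex_body K -> bisecting_width K <= width K / 2.
Proof.
move=> hK; have [cK _ _] := hK.
rewrite -(ler_pM2r (_ : 0 < 2)) // divfK //.
apply: lb_le_inf; first exact: compact_strip cK (@subset_refl _ K).
move=> _ [u [a [b [hs ->]]]].
have [K1 [K2 [bis h]]] := middle_bisection K u a b hK hs.
rewrite -ler_pdivlMr //; apply: le_trans h.
apply: ge_inf; last by exists K1, K2.
exists 0 => _ [L1 [L2 [_ ->]]].
by rewrite le_max width_ge0.
Qed.

Lemma bisecting_width_ge {R : realType} (K : set (R * R)) (a b c : R * R) (H : R) :
  0 < dist a b -> dist a b = dist b c -> dist b c = dist c a ->
  H ^+ 2 = 3 / 4 * dist a b ^+ 2 -> convex_body K -> triangle a b c `<=` K ->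
  H / 2 <= bisecting_width K.
Proof.
move=> d0 e1 e2 eH hK TK; have [cK _ _] := hK.
apply: lb_le_inf.
  have [_ [u [a' [b' [hs _]]]]] := compact_strip _ _ cK (@subset_refl _ K).
  have [K1 [K2 [bis _]]] := middle_bisection K u a' b' hK hs.
  by exists (Num.max (width K1) (width K2)), K1, K2.
move=> _ [K1 [K2 [bis ->]]].
exact: (bisection_width_ge K K1 K2 a b c).
Qed.

(** Combined with [bisecting_width_ge], this makes the bisecting width positive, so that the
    quotient in the theorem is a genuine one. *)
Lemma equilateral_inside {R : realType} (K : set (R * R)) : convex_body K ->
  exists a b c, [/\ 0 < dist a b, dist a b = dist b c, dist b c = dist c a &
    triangle a b c `<=` K].
Proof.
move=> [_ vK [x /interior_square[e e0 he]]].
pose d := e / 2; have d0 : 0 < d by rewrite divr_gt0.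
pose b := (x.1 + d, x.2); pose c := (x.1 + d / 2, x.2 + Num.sqrt 3 / 2 * d).
have s3 : Num.sqrt 3 ^+ 2 = 3 :> R by rewrite sqr_sqrtr.
have s0 : 0 <= Num.sqrt 3 :> R by exact: sqrtr_ge0.
have s2 : Num.sqrt 3 <= 2 :> R by nra.
have sq r s : 0 <= r -> 0 <= s -> r ^+ 2 = s ^+ 2 -> r = s :> R.
  by move=> r0 s0' /eqP; rewrite eqrXn2 // => /eqP.
have dE y z : dist y z ^+ 2 = d ^+ 2 -> dist y z = d.
  by apply: sq; [exact: dist_ge0|exact: ltW].
have ab : dist x b = d by apply: dE; rewrite dist_sqr /=; ring.
have bc : dist b c = d.
  apply: dE; rewrite dist_sqr /=.
  have -> : (x.1 + d - (x.1 + d / 2)) ^+ 2 +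
     (x.2 - (x.2 + Num.sqrt 3 / 2 * d)) ^+ 2 = (1 + Num.sqrt 3 ^+ 2) / 4 * d ^+ 2 by field.
  by rewrite s3; field.
have ca : dist c x = d.
  apply: dE; rewrite dist_sqr /=.
  have -> : (x.1 + d / 2 - x.1) ^+ 2 +
     (x.2 + Num.sqrt 3 / 2 * d - x.2) ^+ 2 = (1 + Num.sqrt 3 ^+ 2) / 4 * d ^+ 2 by field.
  by rewrite s3; field.
exists x, b, c; rewrite ab bc ca; split=> //.
have ed : d < e by rewrite /d; lra.
have small r : 0 <= r <= d -> `|r| < e.
  by move=> /andP[r0 rd]; rewrite ger0_norm //; exact: le_lt_trans ed.
have Kx : K x by apply: he; rewrite subrr normr0.
have Kb : K b.
  apply: he; rewrite /b /=; last by rewrite subrr normr0.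
  by rewrite addrAC subrr add0r; apply: small; rewrite lexx ltW.
have Kc : K c.
  apply: he; rewrite /c /= addrAC subrr add0r; apply: small.
    by apply/andP; split; lra.
  by apply/andP; split; nra.
exact: (triangle_subset K x b c vK Kx Kb Kc).
Qed.

Lemma equilateral_area {R : realType} (K : set (R * R)) : convex_body K ->
  equilateral_triangle K ->
  0 < bisecting_width K /\
  area K <= 4 / Num.sqrt 3 * bisecting_width K ^+ 2.
Proof.
move=> hK [a [b [c [d0 e1 e2 KT]]]]; have [cK _ _] := hK.
have s3 : Num.sqrt 3 ^+ 2 = 3 :> R by rewrite sqr_sqrtr.
have s0 : 0 < Num.sqrt 3 :> R by rewrite sqrtr_gt0.
(* The height of the triangle; the area [sqrt 3 / 4] times the squared side equals
   [4 / sqrt 3 * (H / 2)^2]. *)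
pose H := Num.sqrt 3 / 2 * dist a b.
have H0 : 0 < H by rewrite mulr_gt0 // divr_gt0.
have eH : H ^+ 2 = 3 / 4 * dist a b ^+ 2 by rewrite /H -[in RHS]s3; field.
have wH : H / 2 <= bisecting_width K.
  by apply: (bisecting_width_ge K a b c) => //; rewrite KT.
have B0 : 0 < bisecting_width K by apply: lt_le_trans wH; rewrite divr_gt0.
split=> //.
have eC : `|cross a b c| = Num.sqrt 3 / 2 * dist a b ^+ 2.
  apply/eqP; rewrite -(@eqrXn2 _ 2) // ?mulr_ge0 ?dist_ge0 ?divr_ge0 ?(ltW s0) //.
  rewrite real_normK ?num_real // equilateral_cross //; apply/eqP.
  by rewrite -[X in X / 4]s3; field.
have aK : area K <= `|cross a b c| / 2.
  rewrite -lee_fin -compact_area //.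
  have clos (x y z : R * R) : 0 < cross x y z -> triangle x y z = closed_triangle x y z.
    by move=> h; apply/seteqP; split=> t /(triangle_cross _ _ _ _ h).
  have [neg|pos|z] := ltgtP (cross a b c) 0.
  - have pos : 0 < cross a c b by rewrite cross_swap oppr_gt0.
    rewrite KT -triangle_swap clos // ltr0_norm // -cross_swap.
    exact: closed_triangle_le.
  - by rewrite KT clos // gtr0_norm //; exact: closed_triangle_le.
  - by have := equilateral_cross_neq0 a b c d0 e1 e2; rewrite z eqxx.
apply: (le_trans aK); rewrite eC.
apply: (@le_trans _ _ (4 / Num.sqrt 3 * (H / 2) ^+ 2)).
  have -> : 4 / Num.sqrt 3 * (H / 2) ^+ 2 = Num.sqrt 3 / 4 * dist a b ^+ 2.
    by rewrite /H; field; rewrite gt_eqF.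
  by rewrite le_eqVlt; apply/orP; left; apply/eqP; field.
rewrite ler_pM2l ?divr_gt0 // lerXn2r // nnegrE ltW //.
by rewrite divr_gt0.
Qed.

Theorem theorem1p4 (R : realType) (K : set (R * R)) (hK : convex_body K) :
  area K / bisecting_width K ^+ 2 >= 4 / Num.sqrt 3 /\
  (area K / bisecting_width K ^+ 2 = 4 / Num.sqrt 3 <-> equilateral_triangle K).
Proof.
have [a [b [c [d0 e1 e2 TK]]]] := equilateral_inside K hK.
have s0 : 0 < Num.sqrt 3 :> R by rewrite sqrtr_gt0.
have B0 : 0 < bisecting_width K.
  have eH : (Num.sqrt 3 / 2 * dist a b) ^+ 2 = 3 / 4 * dist a b ^+ 2.
    by rewrite -[in RHS](@sqr_sqrtr R 3) //; field.
  apply: lt_le_trans (bisecting_width_ge K a b c _ d0 e1 e2 eH hK TK).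
  by rewrite divr_gt0 // mulr_gt0 // divr_gt0.
have Bw := bisecting_width_le K hK.
have [pal_le pal_eq] := pal_inequality K hK.
have BW : 4 / Num.sqrt 3 * bisecting_width K ^+ 2 <= width K ^+ 2 / Num.sqrt 3.
  have -> : width K ^+ 2 / Num.sqrt 3 = 4 / Num.sqrt 3 * (width K / 2) ^+ 2.
    by field; rewrite gt_eqF.
  by rewrite ler_pM2l ?divr_gt0 // lerXn2r // nnegrE ?(le_trans _ Bw) ?ltW.
have B2 : 0 < bisecting_width K ^+ 2 by rewrite exprn_gt0.
have lower : 4 / Num.sqrt 3 <= area K / bisecting_width K ^+ 2.
  by rewrite ler_pdivlMr //; exact: le_trans pal_le.
split=> //; split=> [e|eqK].
  (* Equality closes the chain [4 / sqrt 3 * w_B^2 <= w^2 / sqrt 3 <= A], so equality holds in Pal's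
     inequality. *)
  apply: pal_eq; last by move: Bw B0; lra.
  apply/eqP; rewrite eq_le pal_le /=; apply: le_trans BW.
  by rewrite -e divfK // gt_eqF.
apply/eqP; rewrite eq_le lower andbT ler_pdivrMr //.
by have [] := equilateral_area K hK eqK.
Qed.
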